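(* Let $(X,Y)$ be a random pair with $X\in[0,1]^d$ and $Y\in\{0,1\}$, and assume that $X$ has a density $f$ with respect to Lebesgue measure on $[0,1]^d$ that is finite (bounded above) and bounded away from $0$. Let $D_n=\{(X_1,Y_1),\dots,(X_n,Y_n)\}$ be i.i.d. copies of $(X,Y)$. Fix a constant $\alpha$ with $0<\alpha<1/\log 2$, and let $p_n=\alpha\log n$. Let $g_n$ be the majority-vote classifier associated to the truncated continuous comparison tree $T^0(p_n)$ (drawn independently of $D_n$). Then $g_n$ is consistent, i.e. \[ \mathbb{E}[L_n]=\mathbb{P}(g_n(X)\neq Y)\longrightarrow L^\star\quad\text{as } n\to\infty, \] where $L_n=\mathbb{P}(g_n(X)\neq Y\mid D_n)$ and $L^\star$ is the Bayes error probability of predicting $Y$ from $X$.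
   Context: Distances are Euclidean, $\delta(x,y)=\|x-y\|$. For distinct $x,y\in\mathbb{R}^d$, let $\Delta(x,y)=\{z\in\mathbb{R}^d:\delta(x,z)=\delta(y,z)\}$ (a hyperplane), and let $H_x$ (resp. $H_y$) denote the open half-space bounded by $\Delta(x,y)$ containing $x$ (resp. $y$). A continuous comparison tree $T^0$ is the random infinite binary tree of cells built as follows: the root is $[0,1]^d$; given level $\ell$, for every cell $C$ at level $\ell$, draw $X_1,X_2\in C$ independently according to the distribution of $X$ restricted to (conditioned on) $C$, and define the two children of $C$ as the closures of $C\cap H_{X_1}$ and $C\cap H_{X_2}$. For a sequence $(p_n)$, the truncated tree $T^0(p_n)$ consists of the first $\lfloor p_n\rfloor$ levels of $T^0$; its leaves form a partition $A_{1,n},\dots,A_{2^{\lfloor p_n\rfloor},n}$ of $[0,1]^d$ (up to boundaries). For $x\in[0,1]^d$, $A(x)$ denotes the leaf cell containing $x$. The associated classifier is $g_n(x)=1$ if $\sum_{X_i\in A(x)}\mathbf{1}\{Y_i=1\}\ge\sum_{X_i\in A(x)}\mathbf{1}\{Y_i=0\}$ and $g_n(x)=0$ otherwise. Here $\log$ is the natural logarithm. *)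

(* Defs.v *)
From mathcomp Require Import all_boot all_order all_algebra.
From mathcomp Require Import all_classical all_reals all_analysis.
Set Implicit Arguments. Unset Strict Implicit. Unset Printing Implicit Defensive.
Import Order.TTheory GRing.Theory Num.Theory.
Local Open Scope classical_set_scope.
Local Open Scope ring_scope.

Section ComparisonTree.
Variable R : realType.
Variable d : nat.

Definition pt := (d.-tuple R).

(* squared Euclidean distance (comparisons of delta are comparisons of dist2) *)
Definition dist2 (x y : pt) : R := \sum_(i < d) (tnth x i - tnth y i) ^+ 2.

Definition in_cube (x : pt) : bool := [forall i, (0 <= tnth x i <= 1)%R].

(* Iterated Lebesgue integral over [0,1]^k of the first k coordinates of a
   real sequence (Tonelli: equals the integral w.r.t. Lebesgue measure on
   [0,1]^k for nonnegative measurable integrands). *)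
Fixpoint cube_iter (k : nat) (F : (nat -> R) -> \bar R) : \bar R :=
  match k with
  | 0 => F (fun _ => 0)
  | k'.+1 => (\int[@lebesgue_measure R]_(t in `[0%R, 1%R])
               cube_iter k' (fun v => F (fun i => if i is j.+1 then v j else t)))%E
  end.

Definition cube_int (G : pt -> \bar R) : \bar R :=
  cube_iter d (fun v => G (mktuple (fun i : 'I_d => v (val i)))).

(* The law P of (X, Y) on R^d x {0,1} (Y = 1 <-> true).
   X has density f w.r.t. Lebesgue measure on [0,1]^d. *)
Definition has_density (P : probability (pt * bool)%type R) (f : pt -> R) :=
  forall A : set pt, measurable A ->
    P (A `*` setT) = cube_int (fun x => (f x * (\1_A x))%:E).

Section WithLaw.
Variable P : probability (pt * bool)%type R.

Definition cond_int (C : pt -> bool) (G : pt -> \bar R) : \bar R :=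
  ((\int[P]_w (G w.1 * ((C w.1)%:R)%:E)) *
    ((fine (P [set w | C w.1]))^-1)%:E)%E.

(* Tree nodes are numbered in heap order: root = 1, children of k are 2k
   (child 0) and 2k+1 (child 1); node k is at level floor(log2 k).
   The two pivots X_1, X_2 drawn in the cell of node k are stored at
   Z (2k) and Z (2k+1).  The child 2k+b is the closure of
   C /\ H_{Z(2k+b)}, i.e. the points of C at least as close to Z(2k+b) as
   to Z(2k+1-b). *)
Fixpoint in_cell_fuel (Z : nat -> pt) (fuel k : nat) (x : pt) : bool :=
  match fuel with
  | 0 => in_cube x
  | fuel'.+1 =>
      if (k <= 1)%N then in_cube x
      else let m := k./2 in
           [&& dist2 x (Z (2 * m + odd k)%N) <= dist2 x (Z (2 * m + ~~ odd k)%N)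
             & in_cell_fuel Z fuel' m x]
  end.

Definition in_cell (Z : nat -> pt) (k : nat) (x : pt) : bool := in_cell_fuel Z k k x.

Definition upd2 (Z : nat -> pt) (k : nat) (a b : pt) : nat -> pt :=
  fun j => if j == (2 * k)%N then a else if j == (2 * k).+1 then b else Z j.

(* Expectation over the random truncated tree: nodes k, k+1, ... (fuel of
   them) are processed sequentially in heap order; for each node the two
   pivots are drawn independently from the law of X conditioned on the
   node's cell (which only depends on pivots of ancestors). *)
Fixpoint tree_int (fuel k : nat) (Z : nat -> pt) (F : (nat -> pt) -> \bar R)
  : \bar R :=
  match fuel with
  | 0 => F Z
  | fuel'.+1 =>
      cond_int (in_cell Z k) (fun a =>
        cond_int (in_cell Z k) (fun b => tree_int fuel' k.+1 (upd2 Z k a b) F))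
  end.

Definition Z0 : nat -> pt := fun _ => mktuple (fun _ => 0).

(* Expectation over the truncated tree T^0(p): nodes 1 .. 2^p - 1 (levels
   0 .. p-1) are split, leaves are the 2^p nodes of level p. *)
Definition tree_expect (p : nat) (F : (nat -> pt) -> \bar R) : \bar R :=
  tree_int (2 ^ p - 1) 1 Z0 F.

Fixpoint leaf (Z : nat -> pt) (x : pt) (l k : nat) : nat :=
  match l with
  | 0 => k
  | l'.+1 => leaf Z x l'
      (2 * k + (if (dist2 x (Z (2 * k)%N) <= dist2 x (Z (2 * k).+1))%R then 0 else 1))%N
  end.

Definition classifier (Z : nat -> pt) (p : nat) (D : seq (pt * bool)) (x : pt)
  : bool :=
  let l := leaf Z x p 1 in
  (count (fun w => (leaf Z w.1 p 1 == l) && ~~ w.2) D <=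
   count (fun w => (leaf Z w.1 p 1 == l) && w.2) D)%N.

Fixpoint data_int (n : nat) (F : seq (pt * bool) -> \bar R) : \bar R :=
  match n with
  | 0 => F [::]
  | n'.+1 => (\int[P]_w data_int n' (fun D => F (w :: D)))%E
  end.

Definition depth (alpha : R) (n : nat) : nat := Num.truncn (alpha * ln n%:R).

Definition expected_error (alpha : R) (n : nat) : \bar R :=
  tree_expect (depth alpha n) (fun Z =>
    data_int n (fun D =>
      P [set w | classifier Z (depth alpha n) D w.1 != w.2])).

Definition bayes_error : \bar R :=
  ereal_inf [set P [set w | g w.1 != w.2] |
             g in [set g : pt -> bool | measurable_fun setT g]].

End WithLaw.
End ComparisonTree.

(* Main.v *)
(** For a cell [A], let [W A] be its scatter, the integral over [A] of the
    squared distance to the mean of [A].  If [W A >= v mu(A)], then among finitely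
    many small boxes there are two, well separated, each carrying a fixed
    fraction of [mu(A)]; when the two pivots fall into them the bisector separates
    them, and the scatter drops by a fixed fraction.  Hence
    [E (W A' + W A'') <= (1 - lam) W A + lam v mu(A)], and the total scatter of
    the leaves tends to 0 in expectation as the depth grows.  No convexity of the
    cells is used.

    The sets [B] such that small total scatter forces almost every leaf to lie
    mostly inside or mostly outside [B], uniformly over partitions, form a
    sigma-algebra containing the coordinate half-spaces, so they include every
    measurable set, in particular that of a nearly optimal classifier.  On top
    of this approximation error, the majority vote costs at most
    [E |S_k / n - E S_k / n|] in the leaf [k], where [S_k] is the signed vote count;
    by the variance bound this sums to [O(sqrt (2^p / n))], which tends to 0 as
    [alpha log 2 < 1].

    The expectation over the tree is an iterated integral of functions of the
    pivots whose measurability is never needed: integrals of nonnegative functions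
    are lower integrals, hence monotone, and every bound is by an explicit simple
    function of the pivot being integrated. *)

Require Import Defs.
From mathcomp Require Import all_boot all_order all_algebra.
From mathcomp Require Import all_classical all_reals all_analysis.
From mathcomp Require Import measurable_realfun ring lra zify.
Set Implicit Arguments. Unset Strict Implicit. Unset Printing Implicit Defensive.
Import Order.TTheory GRing.Theory Num.Theory.
Import numFieldNormedType.Exports.
Local Open Scope classical_set_scope.
Local Open Scope ring_scope.

(** * Lower integrals and bounded expectations *)

Section LowerIntegral.
Context (d0 : measure_display) (T : measurableType d0) (R : realType).
Variable mu : {measure set T -> \bar R}.
Local Open Scope ereal_scope.

(* No measurability is needed: the integral of a nonnegative function is a
   supremum over the simple functions below it. *)
Lemma le_lower_integral (D : set T) (F G : T -> \bar R) :
  (forall x, D x -> 0 <= F x) -> (forall x, D x -> F x <= G x) ->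
  \int[mu]_(x in D) F x <= \int[mu]_(x in D) G x.
Proof.
move=> F0 FG; have G0 x : D x -> 0 <= G x.
  by move=> Dx; exact: le_trans (F0 x Dx) (FG x Dx).
rewrite !ge0_integralE//; apply: le_ereal_sup => _ [h hF <-].
exists h => // x; apply: le_trans (hF x) _.
by apply: lee_restrict => y; rewrite ?inE; exact: FG.
Qed.

End LowerIntegral.

Section BoundedExpectation.
Context (d0 : measure_display) (T : measurableType d0) (R : realType).
Variable P : probability T R.
Implicit Types (f g : T -> R) (A B : T -> bool).

Definition bm f := measurable_fun setT f /\ exists M : R, forall x, `|f x| <= M.

Definition Ex f : R := fine (\int[P]_x (f x)%:E)%E.

Definition ind A : T -> R := fun x => (A x)%:R.

Lemma bm_cst (c : R) : bm (fun=> c).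
Proof. by split => //; exists `|c|. Qed.

Lemma bmD f g : bm f -> bm g -> bm (fun x => f x + g x).
Proof.
move=> [mf [M fM]] [mg [N gN]]; split; first exact: measurable_funD.
by exists (M + N) => x; apply: le_trans (ler_normD _ _) _; exact: lerD.
Qed.

Lemma bmM f g : bm f -> bm g -> bm (fun x => f x * g x).
Proof.
move=> [mf [M fM]] [mg [N gN]]; split; first exact: measurable_funM.
by exists (M * N) => x; rewrite normrM; exact: ler_pM.
Qed.

Lemma bmZ (c : R) f : bm f -> bm (fun x => c * f x).
Proof. by move=> bf; apply: bmM => //; exact: bm_cst. Qed.

Lemma bmN f : bm f -> bm (fun x => - f x).
Proof.
move=> bf; rewrite (_ : (fun x => _) = (fun x => -1 * f x)); first exact: bmZ.
by apply/funext => x; rewrite mulN1r.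
Qed.

Lemma bmB f g : bm f -> bm g -> bm (fun x => f x - g x).
Proof. by move=> bf bg; apply: bmD => //; exact: bmN. Qed.

Lemma bmX f (n : nat) : bm f -> bm (fun x => f x ^+ n).
Proof.
move=> bf; elim: n => [|n IH].
  by rewrite (_ : (fun x => _) = (fun=> 1)); [exact: bm_cst|apply/funext => x].
rewrite (_ : (fun x => _) = (fun x => f x * f x ^+ n)); first exact: bmM.
by apply/funext => x; rewrite exprS.
Qed.

Lemma bm_sum (I : Type) (s : seq I) (F : I -> T -> R) :
  (forall i, bm (F i)) -> bm (fun x => \sum_(i <- s) F i x).
Proof.
move=> bF; elim: s => [|i s IH].
  by under eq_fun do rewrite big_nil; exact: bm_cst.
by under eq_fun do rewrite big_cons; exact: bmD.
Qed.

Lemma bm_ind A : measurable_fun setT A -> bm (ind A).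
Proof.
move=> mA; split; last first.
  by exists 1 => x; rewrite /ind; case: (A x); rewrite ?normr1 ?normr0.
rewrite (_ : ind A = fun x => if A x then 1 else 0); last first.
  by apply/funext => x; rewrite /ind; case: (A x).
exact: measurable_fun_ifT.
Qed.

Lemma bm_integrable f : bm f -> P.-integrable setT (EFin \o f).
Proof.
move=> [mf [M fM]]; apply: measurable_bounded_integrable => //.
  by rewrite [X in (X < _)%E](_ : _ = 1%E) ?ltry//; exact: probability_setT.
exists M; split; first exact: num_real.
by move=> y My x _; apply: le_trans (fM x) (ltW My).
Qed.

Lemma Ex_int f : bm f -> (\int[P]_x (f x)%:E)%E = (Ex f)%:E.
Proof. by move=> /bm_integrable/integrable_fin_num => /(_ measurableT) /fineK. Qed.

Lemma ExD f g : bm f -> bm g -> Ex (fun x => f x + g x) = Ex f + Ex g.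
Proof. by move=> bf bg; apply: RintegralD => //; exact: bm_integrable. Qed.

Lemma ExB f g : bm f -> bm g -> Ex (fun x => f x - g x) = Ex f - Ex g.
Proof. by move=> bf bg; apply: RintegralB => //; exact: bm_integrable. Qed.

Lemma ExZ (c : R) f : bm f -> Ex (fun x => c * f x) = c * Ex f.
Proof. by move=> bf; apply: RintegralZl => //; exact: bm_integrable. Qed.

Lemma Ex_cst (c : R) : Ex (fun=> c) = c.
Proof.
rewrite /Ex integral_cst// [X in (_ * X)%E](_ : _ = 1%E) ?mule1//.
exact: probability_setT.
Qed.

Lemma Ex_le f g : bm f -> bm g -> (forall x, f x <= g x) -> Ex f <= Ex g.
Proof.
by move=> bf bg fg; apply: le_Rintegral => //; exact: bm_integrable.
Qed.

Lemma Ex_ge0 f : (forall x, 0 <= f x) -> 0 <= Ex f.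
Proof. by move=> f0; apply: Rintegral_ge0. Qed.

Lemma Ex_sum (I : Type) (s : seq I) (F : I -> T -> R) :
  (forall i, bm (F i)) ->
  Ex (fun x => \sum_(i <- s) F i x) = \sum_(i <- s) Ex (F i).
Proof.
move=> bF; elim: s => [|i s IH].
  by under eq_fun do rewrite big_nil; rewrite big_nil Ex_cst.
under eq_fun do rewrite big_cons.
by rewrite ExD// ?IH ?big_cons//; exact: bm_sum.
Qed.

Lemma Ex_ext f g : f =1 g -> Ex f = Ex g.
Proof. by move=> /funext ->. Qed.

Lemma measurable_set_bool A : measurable_fun setT A -> measurable [set x | A x].
Proof.
move=> mA; rewrite -[X in measurable X]setTI.
by rewrite (_ : [set x | A x] = A @^-1` [set true])//; exact: mA.
Qed.

Lemma Ex_ind A : measurable_fun setT A -> P [set x | A x] = (Ex (ind A))%:E.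
Proof.
move=> mA; rewrite -Ex_int; last exact: bm_ind.
rewrite -[[set x | A x]]setIT -integral_indic//; last exact: measurable_set_bool.
apply: eq_integral => x _; rewrite /ind indicE.
suff -> : (x \in [set y | A y]) = A x by [].
by apply/idP/idP; rewrite inE.
Qed.

Lemma measurable_mem (N : set T) :
  measurable N -> measurable_fun setT (fun x => x \in N).
Proof.
move=> mN; apply: (measurable_fun_bool true); rewrite setTI.
rewrite (_ : _ @^-1` _ = N)//.
by apply/seteqP; split => x /=; [move=> /set_mem|move=> /mem_set].
Qed.

(** No regularity of [F] is assumed: raising the bound to [+oo] on the null set [N] gives a
    measurable majorant, valid everywhere, with the same integral as [g]. *)
Lemma lower_integral_le_ae (N : set T) (F : T -> \bar R) g :
  measurable N -> P N = 0%E -> bm g -> (forall x, (0 <= F x)%E) ->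
  (forall x, ~ N x -> (F x <= (g x)%:E)%E) ->
  (\int[P]_x F x <= (Ex g)%:E)%E.
Proof.
move=> mN N0 bg F0 Fg; rewrite -Ex_int//.
pose H x : \bar R := if x \in N then +oo%E else (g x)%:E.
apply: (@le_trans _ _ (\int[P]_x H x)%E).
  apply: le_lower_integral => x _ //; rewrite /H.
  case: ifPn => [_|/negP xN]; first exact: leey.
  by apply: Fg => Nx; apply: xN; rewrite inE.
rewrite (ae_eq_integral (fun x => (g x)%:E))//.
- apply: measurable_fun_ifT => //; last by apply/measurable_EFinP; case: bg.
  exact: measurable_mem.
- by apply/measurable_EFinP; case: bg.
- exists N; split => // x /= /not_implyP[_]; rewrite /H.
  by case: ifPn => // xN _; rewrite inE in xN.
Qed.

(** Dual argument: the minorant is lowered to 0 on [N], where only [0 <= F] is known. *)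
Lemma lower_integral_ge_ae (N : set T) (F : T -> \bar R) g :
  measurable N -> P N = 0%E -> bm g -> (forall x, 0 <= g x) ->
  (forall x, (0 <= F x)%E) ->
  (forall x, ~ N x -> ((g x)%:E <= F x)%E) ->
  ((Ex g)%:E <= \int[P]_x F x)%E.
Proof.
move=> mN N0 bg g0 F0 Fg; rewrite -Ex_int//.
have mb := measurable_mem mN.
pose H x : \bar R := if x \in N then 0%E else (g x)%:E.
apply: (@le_trans _ _ (\int[P]_x H x)%E); last first.
  apply: le_lower_integral => x _ //; rewrite /H.
    by case: ifPn => // _; rewrite lee_fin.
  case: ifPn => [_|/negP xN] //.
  by apply: Fg => Nx; apply: xN; rewrite inE.
rewrite (ae_eq_integral H)//.
- by apply/measurable_EFinP; case: bg.
- by apply: measurable_fun_ifT => //; apply/measurable_EFinP; case: bg.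
- exists N; split => // x /= /not_implyP[_]; rewrite /H.
  by case: ifPn => // xN _; rewrite inE in xN.
Qed.

End BoundedExpectation.

(** * Cells and grid boxes *)

Lemma measurable_forallb (d0 : measure_display) (T : measurableType d0)
  (I : finType) (F : I -> T -> bool) :
  (forall i, measurable_fun setT (F i)) ->
  measurable_fun setT (fun x => [forall i, F i x]).
Proof.
move=> mF.
rewrite (_ : (fun x => _) = (fun x => all (F^~ x) (enum I))); last first.
  apply/funext => x; apply/forallP/allP => [Fx i _|Fx i]; first exact: Fx.
  by apply: Fx; rewrite mem_enum.
elim: (enum I) => [|i s IH]; first exact: measurable_cst.
exact: measurable_and.
Qed.

Section Geometry.
Variables (R : realType) (d : nat).
Local Notation pt := (pt R d).
Implicit Types (x y a b : pt) (Z : nat -> pt).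

(** * Measurability and elementary inequalities for squared distances *)

Lemma measurable_coord (i : 'I_d) : measurable_fun setT (fun x : pt => tnth x i).
Proof. exact: measurable_tnth. Qed.

Lemma measurable_dist2 z : measurable_fun setT (fun x : pt => dist2 x z).
Proof.
apply: measurable_sum => i; apply: measurable_funX; apply: measurable_funB => //.
exact: measurable_coord.
Qed.

Lemma measurable_in_cube : measurable_fun setT (@in_cube R d).
Proof.
apply: measurable_forallb => i; apply: measurable_and; apply: measurable_fun_ler => //;
  exact: measurable_coord.
Qed.

Lemma in_cubeP x : reflect (forall i, 0 <= tnth x i <= 1) (in_cube x).
Proof. exact: forallP. Qed.

Lemma dist2_ge0 x y : 0 <= dist2 x y.
Proof. by apply: sumr_ge0 => i _; exact: sqr_ge0. Qed.

Lemma dist2C x y : dist2 x y = dist2 y x.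
Proof. by apply: eq_bigr => i _; ring. Qed.

Lemma dist2_eq0 x y : dist2 x y = 0 -> x = y.
Proof.
move/eqP; rewrite psumr_eq0; last by move=> i _; exact: sqr_ge0.
move=> /allP xy; apply: eq_from_tnth => i; apply/eqP.
by have := xy i; rewrite mem_index_enum sqrf_eq0 subr_eq0 => /(_ isT).
Qed.

Lemma dist2_le_cube x y : in_cube x -> in_cube y -> dist2 x y <= d%:R.
Proof.
move=> /in_cubeP x01 /in_cubeP y01.
rewrite -[leRHS]mulr1 mulr_natl -[in leRHS](card_ord d) -sumr_const.
by apply: ler_sum => i _; have := x01 i; have := y01 i; nra.
Qed.

Lemma dist2_tri x a y : dist2 x y <= 2 * (dist2 x a + dist2 a y).
Proof.
rewrite /dist2 -big_split/= mulr_sumr; apply: ler_sum => i _.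
by have := sqr_ge0 (tnth x i - tnth a i - (tnth a i - tnth y i)); nra.
Qed.

Lemma dist2_tri3 x a b y :
  dist2 x y <= 3 * (dist2 x a + dist2 a b + dist2 b y).
Proof.
rewrite /dist2 -!big_split/= mulr_sumr; apply: ler_sum => i _.
set p := tnth x i - tnth a i; set q := tnth a i - tnth b i.
set r := tnth b i - tnth y i.
have -> : tnth x i - tnth y i = p + q + r by rewrite /p /q /r; ring.
by have := sqr_ge0 (p - q); have := sqr_ge0 (q - r); have := sqr_ge0 (p - r); nra.
Qed.

(** For [M > 0] these are closed boxes of side [1/M]. Indices run up to [M] because truncating
    [M * x_i] returns [M] on the face [x_i = 1]. *)
Definition box (M : nat) (j : {ffun 'I_d -> 'I_M.+1}) x :=
  in_cube x && [forall i, (j i)%:R <= M%:R * tnth x i <= (j i).+1%:R].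

Lemma measurable_box (M : nat) (j : {ffun 'I_d -> 'I_M.+1}) :
  measurable_fun setT (box j).
Proof.
apply: measurable_and; first exact: measurable_in_cube.
apply: measurable_forallb => i; apply: measurable_and; apply: measurable_fun_ler => //;
  apply: measurable_funM => //; exact: measurable_coord.
Qed.

Lemma box_cover (M : nat) x : in_cube x ->
  exists j : {ffun 'I_d -> 'I_M.+1}, box j x.
Proof.
move=> x01; exists [ffun i => inord (Num.truncn (M%:R * tnth x i))].
rewrite /box x01; apply/forallP => i; rewrite ffunE.
have /andP[xi0 xi1] := in_cubeP _ x01 i.
have Mx0 : 0 <= M%:R * tnth x i by rewrite mulr_ge0.
have /andP[t1 t2] := truncn_itv Mx0.
rewrite inordK ?t1 ?(ltW t2)// ltnS -(ler_nat R); apply: le_trans t1 _.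
by rewrite ler_piMr.
Qed.

Lemma box_diam (M : nat) (j : {ffun 'I_d -> 'I_M.+1}) x y :
  box j x -> box j y -> M%:R ^+ 2 * dist2 x y <= d%:R.
Proof.
move=> /andP[_ /forallP xj] /andP[_ /forallP yj].
rewrite -[leRHS]mulr1 mulr_natl -[in leRHS](card_ord d) -sumr_const.
rewrite /dist2 mulr_sumr; apply: ler_sum => i _.
have := xj i; have := yj i; rewrite -!natr1 => /andP[y1 y2] /andP[x1 x2].
rewrite -exprMn mulrBr; set u := M%:R * tnth x i in x1 x2 *.
set v := M%:R * tnth y i in y1 y2 *.
have h1 : u - v <= 1 by lra.
have h2 : -1 <= u - v by lra.
by nra.
Qed.

(** It suffices that the squared diameter of the boxes be below a quarter of [dist2 a b]. A whole
    box around [a] on the side of [a] is what gives the child of a pivot positive mass. *)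
Lemma box_separation a b : a <> b -> exists M : nat,
  forall (j : {ffun 'I_d -> 'I_M.+1}) x, box j a -> box j x ->
    dist2 x a < dist2 x b.
Proof.
move=> ab; have ab0 : 0 < dist2 a b.
  by rewrite lt_neqAle dist2_ge0 andbT eq_sym; apply/eqP => /dist2_eq0.
pose M := (Num.truncn (4 * d%:R / dist2 a b)).+1.
have Mlt : 4 * d%:R / dist2 a b < M%:R by exact: truncnS_gt.
exists M => j x ja jx.
have M1 : (1 : R) <= M%:R by rewrite ler1n.
have h := box_diam jx ja.
have t := dist2_tri a x b; rewrite (dist2C a x) in t.
rewrite ltr_pdivrMr// in Mlt.
have xa0 := dist2_ge0 x a.
have MD : M%:R * dist2 x a <= d%:R.
  by apply: le_trans h; rewrite expr2 -mulrA ler_peMl// mulr_ge0.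
(* If [x] were no closer to [a] than to [b], the triangle bound would give
   [dist2 a b <= 4 * dist2 x a], against the choice of [M]. *)
rewrite ltNge; apply/negP => le_ba.
have : M%:R * dist2 a b <= M%:R * (4 * dist2 x a) by rewrite ler_wpM2l//; lra.
by lra.
Qed.

(** The test [t] made at each node is a parameter, so that closed and half-open cells share one
    recursion along the path to the root. *)
Fixpoint gcell_fuel (t : nat -> pt -> bool) (fuel k : nat) x : bool :=
  match fuel with
  | 0 => in_cube x
  | fuel'.+1 => if (k <= 1)%N then in_cube x else t k x && gcell_fuel t fuel' k./2 x
  end.

Definition gcell t k x := gcell_fuel t k k x.

Section GCell.
Variable t : nat -> pt -> bool.

Lemma gcell_fuel_irr (m n k : nat) x : (k <= m)%N -> (k <= n)%N ->
  gcell_fuel t m k x = gcell_fuel t n k x.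
Proof.
elim: m n k => [|m IH] [|n] k //=; [by case: k|by case: k|].
move=> km kn; case: ifPn => // k1; congr andb; apply: IH; lia.
Qed.

Lemma gcell1 (k : nat) x : (k <= 1)%N -> gcell t k x = in_cube x.
Proof. by case: k => [|[|k]]. Qed.

Lemma gcell_half (k : nat) x : (1 < k)%N ->
  gcell t k x = t k x && gcell t k./2 x.
Proof.
case: k => // k k1; rewrite /gcell [LHS]/= leqNgt k1/=; congr andb.
apply: gcell_fuel_irr => //; lia.
Qed.

Lemma gcell_cube (k : nat) x : gcell t k x -> in_cube x.
Proof.
elim/ltn_ind: k => k IH; case: (leqP k 1) => k1; first by rewrite gcell1.
by rewrite gcell_half// => /andP[_]; apply: IH; lia.
Qed.

Lemma measurable_gcell (k : nat) :
  (forall j, measurable_fun setT (t j)) -> measurable_fun setT (gcell t k).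
Proof.
move=> mt; elim/ltn_ind: k => k IH; case: (leqP k 1) => k1.
  rewrite (_ : gcell t k = @in_cube R d); first exact: measurable_in_cube.
  by apply/funext => x; rewrite gcell1.
rewrite (_ : gcell t k = fun x => t k x && gcell t k./2 x); last first.
  by apply/funext => x; rewrite gcell_half.
by apply: measurable_and => //; apply: IH; lia.
Qed.

End GCell.

Lemma eq_gcell (t t' : nat -> pt -> bool) (k : nat) x :
  (forall j, (1 < j <= k)%N -> t j x = t' j x) -> gcell t k x = gcell t' k x.
Proof.
elim/ltn_ind: k => k IH tt'; case: (leqP k 1) => k1; first by rewrite !gcell1.
rewrite (@gcell_half t k)// (@gcell_half t' k)// tt'; last lia.
by congr andb; apply: IH => [|j jk]; [lia|apply: tt'; lia].
Qed.

Lemma sub_gcell (t t' : nat -> pt -> bool) (k : nat) x :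
  (forall j, t j x -> t' j x) -> gcell t k x -> gcell t' k x.
Proof.
move=> tt'; elim/ltn_ind: k => k IH; case: (leqP k 1) => k1.
  by rewrite !gcell1.
rewrite (@gcell_half t k)// (@gcell_half t' k)// => /andP[/tt' -> tk].
by apply: IH => //; lia.
Qed.

Definition ccmp Z (k : nat) x :=
  dist2 x (Z (2 * k./2 + odd k)%N) <= dist2 x (Z (2 * k./2 + ~~ odd k)%N).

(** One comparison of the two pivots of the parent, negated for the odd child, makes siblings exact
    complements inside the parent. *)
Definition hcmp Z (k : nat) x :=
  odd k != (dist2 x (Z (2 * k./2)%N) <= dist2 x (Z (2 * k./2).+1)).

(* Half-open version of [in_cell], ties going to the even child as in [leaf]:
   the half-open cells of a level partition the cube. *)
Definition hcell Z (k : nat) x := gcell (hcmp Z) k x.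

Lemma in_cellE Z (k : nat) x : in_cell Z k x = gcell (ccmp Z) k x.
Proof.
rewrite /in_cell /gcell; elim: k {2 4}k => //= n IH k.
by case: ifP => // _; rewrite IH.
Qed.

Lemma hcmp_ccmp Z (k : nat) x : hcmp Z k x -> ccmp Z k x.
Proof.
rewrite /hcmp /ccmp; case: (odd k); rewrite /= ?addn0 ?addn1 ?eqbF_neg ?negbK//.
by rewrite eq_sym eqb_id -ltNge => /ltW.
Qed.

Lemma hcell_in_cell Z (k : nat) x : hcell Z k x -> in_cell Z k x.
Proof. by rewrite in_cellE; apply: sub_gcell => j; exact: hcmp_ccmp. Qed.

Lemma measurable_in_cell Z (k : nat) : measurable_fun setT (in_cell Z k).
Proof.
rewrite (_ : in_cell Z k = gcell (ccmp Z) k); last first.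
  by apply/funext => x; rewrite in_cellE.
by apply: measurable_gcell => j; apply: measurable_fun_ler; exact: measurable_dist2.
Qed.

Lemma measurable_hcell Z (k : nat) : measurable_fun setT (hcell Z k).
Proof.
apply: measurable_gcell => j; rewrite /hcmp.
have m : measurable_fun setT
    (fun x => dist2 x (Z (2 * j./2)%N) <= dist2 x (Z (2 * j./2).+1)).
  by apply: measurable_fun_ler; exact: measurable_dist2.
case: (odd j); last by under eq_fun do rewrite eq_sym eqbF_neg negbK.
by under eq_fun do rewrite eq_sym eqb_id; exact: measurable_neg.
Qed.

(** * Effect on the cells of drawing the pivots of one node *)

Section Update.
Variables (Z : nat -> pt) (k : nat) (a b : pt).
Local Notation Z' := (upd2 Z k a b).

Lemma upd2_lt (j : nat) : (j < 2 * k)%N -> Z' j = Z j.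
Proof. by move=> jk; rewrite /upd2; case: eqP => [|_]; [lia|case: eqP => //; lia]. Qed.

Lemma upd2_0 : Z' (2 * k)%N = a. Proof. by rewrite /upd2 eqxx. Qed.

Lemma upd2_1 : Z' (2 * k).+1 = b.
Proof. by rewrite /upd2 eqxx; case: eqP => //; lia. Qed.

Lemma hcell_upd_lt (j : nat) x : (j < 2 * k)%N -> hcell Z' j x = hcell Z j x.
Proof.
move=> jk; apply: eq_gcell => i ij; rewrite /hcmp !upd2_lt//; lia.
Qed.

Lemma in_cell_upd_lt (j : nat) x : (j < 2 * k)%N -> in_cell Z' j x = in_cell Z j x.
Proof.
move=> jk; rewrite !in_cellE; apply: eq_gcell => i ij.
by rewrite /ccmp !upd2_lt//; lia.
Qed.

Hypothesis k0 : (0 < k)%N.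

Let half0 : (2 * k)./2 = k. Proof. by lia. Qed.
Let half1 : (2 * k).+1./2 = k. Proof. by lia. Qed.
Let odd0 : odd (2 * k) = false. Proof. by lia. Qed.
Let odd1 : odd (2 * k).+1 = true. Proof. by lia. Qed.
Let klt : (k < 2 * k)%N. Proof. by lia. Qed.

Lemma in_cell_upd0 x :
  in_cell Z' (2 * k) x = (dist2 x a <= dist2 x b) && in_cell Z k x.
Proof.
rewrite in_cellE gcell_half ?half0; last lia.
by rewrite -in_cellE in_cell_upd_lt// /ccmp half0 odd0/= addn0 addn1 upd2_0 upd2_1.
Qed.

Lemma in_cell_upd1 x :
  in_cell Z' (2 * k).+1 x = (dist2 x b <= dist2 x a) && in_cell Z k x.
Proof.
rewrite in_cellE gcell_half ?half1; last lia.
by rewrite -in_cellE in_cell_upd_lt// /ccmp half1 odd1/= addn0 addn1 upd2_0 upd2_1.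
Qed.

Lemma hcell_upd0 x :
  hcell Z' (2 * k) x = (dist2 x a <= dist2 x b) && hcell Z k x.
Proof.
rewrite /hcell gcell_half ?half0; last lia.
rewrite -!/(hcell _ _ _) hcell_upd_lt// /hcmp half0 odd0 upd2_0 upd2_1.
by rewrite eq_sym eqbF_neg negbK.
Qed.

Lemma hcell_upd1 x :
  hcell Z' (2 * k).+1 x = ~~ (dist2 x a <= dist2 x b) && hcell Z k x.
Proof.
rewrite /hcell gcell_half ?half1; last lia.
rewrite -!/(hcell _ _ _) hcell_upd_lt// /hcmp half1 odd1 upd2_0 upd2_1.
by rewrite eq_sym eqb_id.
Qed.

End Update.

(** [leaf] descends by updating its accumulator; unrolling its last step instead makes induction on
    the level possible. *)
Lemma leafS Z x (l k : nat) : leaf Z x l.+1 k =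
  (2 * leaf Z x l k + (if (dist2 x (Z (2 * leaf Z x l k)%N) <=
      dist2 x (Z (2 * leaf Z x l k).+1))%R then 0 else 1))%N.
Proof. by elim: l k => // l IH k; rewrite [LHS]IH. Qed.

(** Node [m] is reached exactly when its parent [m./2] is reached and the comparison there agrees
    with the parity of [m]. The point is taken in the cube because [hcell] tests for this and [leaf]
    does not. *)
Lemma leaf_hcell Z x (l m : nat) : in_cube x -> (2 ^ l <= m < 2 ^ l.+1)%N ->
  hcell Z m x = (leaf Z x l 1 == m).
Proof.
move=> x01; elim: l m => [|l IH] m ml.
  by rewrite (_ : m = 1%N) ?/hcell ?gcell1//; rewrite expn0 expn1 in ml; lia.
rewrite !expnS in ml IH *; have p0 : (0 < 2 ^ l)%N by rewrite expn_gt0.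
rewrite /hcell gcell_half -?/(hcell _ _ _); last lia.
rewrite IH; last lia.
rewrite leafS /hcmp; case: (leaf Z x l 1 =P m./2) => [->|lm].
  rewrite andbT; case: ifP => _; case: (boolP (odd m)) => om; apply/esym => /=;
    by [apply/eqP; lia|apply/negbTE/eqP; lia].
by rewrite andbF; apply/esym/negbTE/eqP; case: ifP => _; lia.
Qed.

Lemma measurable_leaf Z (l m : nat) :
  measurable_fun setT (fun x => leaf Z x l 1 == m).
Proof.
elim: l m => [|l IH] m; first by [].
under eq_fun do rewrite leafS.
rewrite (_ : (fun x => _) = (fun x => (leaf Z x l 1 == m./2) &&
  (odd m != (dist2 x (Z (2 * m./2)%N) <= dist2 x (Z (2 * m./2).+1))))); last first.
  apply/funext => x; case: (leaf Z x l 1 =P m./2) => [->|lm].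
    case: ifP => _; case: (boolP (odd m)) => om; rewrite /=;
    by [apply/eqP; lia|apply/negbTE/eqP; lia].
  by apply/negbTE/eqP; case: ifP => _; lia.
apply: measurable_and => //.
have mm : measurable_fun setT
    (fun x => dist2 x (Z (2 * m./2)%N) <= dist2 x (Z (2 * m./2).+1)).
  by apply: measurable_fun_ler; exact: measurable_dist2.
case: (odd m); last by under eq_fun do rewrite eq_sym eqbF_neg negbK.
by under eq_fun do rewrite eq_sym eqb_id; exact: measurable_neg.
Qed.

End Geometry.

(** * Null sets from the density *)

Section Density.
Variable R : realType.

Lemma cube_iter_eq0 (k : nat) (F : (nat -> R) -> \bar R) :
  (forall v : nat -> R, (forall i, (i < k)%N -> 0 <= v i <= 1) -> F v = 0%E) ->
  cube_iter k F = 0%E.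
Proof.
elim: k F => [|k IH] F F0 /=; first by apply: F0.
apply: integral0_eq => t; rewrite /= in_itv/= => t01.
by apply: IH => v v01; apply: F0 => -[|i] //= /v01.
Qed.

Lemma integral_off_point (D : set R) (r : R) (G : R -> \bar R) :
  (forall t, D t -> t <> r -> G t = 0%E) ->
  (\int[@lebesgue_measure R]_(t in D) G t = 0)%E.
Proof.
move=> G0; rewrite (_ : integral _ _ _ =
  (\int[@lebesgue_measure R]_(t in D `&` [set r]) G t)%E).
  by apply: (@integral_Sset1 _ _ _ r); exact: subIsetr.
rewrite integral_mkcondr; apply: eq_integral => t; rewrite inE => Dt.
by rewrite patchE; case: ifPn => //; rewrite notin_setE/=; exact: G0.
Qed.

(* Integrating one coordinate at a time, either the remaining linear form is
   nonzero for every value of the current coordinate, or that coordinate is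
   pinned to a single point. *)
Lemma cube_iter_hyperplane (k : nat) (u : nat -> R) (c : R)
    (F : (nat -> R) -> \bar R) :
  (exists2 i, (i < k)%N & u i != 0) ->
  (forall v : nat -> R, (forall i, (i < k)%N -> 0 <= v i <= 1) ->
    \sum_(i < k) u i * v i != c -> F v = 0%E) ->
  cube_iter k F = 0%E.
Proof.
elim: k u c F => [|k IH] u c F [i ik ui] F0 //=.
have [[j jk uj]|uS] := pselect (exists2 j, (j < k)%N & u j.+1 != 0).
  apply: integral0_eq => t; rewrite /= in_itv/= => t01.
  apply: (IH (fun j => u j.+1) (c - u 0%N * t)); first by exists j.
  move=> v v01 hv; apply: F0 => [[|l]|] //=; first by move=> /v01.
  apply: contra hv; rewrite big_ord_recl/= => /eqP <-.
  by rewrite addrC addrA addNr add0r.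
have uS0 j : (j < k)%N -> u j.+1 = 0.
  by move=> jk; apply/eqP/negPn/negP => uj; apply: uS; exists j.
have u0 : u 0%N != 0.
  by case: i ik ui => // j jk; rewrite uS0 ?eqxx.
apply: (@integral_off_point _ (c / u 0%N)) => t; rewrite /= in_itv/= => t01 tc.
apply: cube_iter_eq0 => v v01; apply: F0 => [[|l]|] //=; first by move=> /v01.
rewrite big_ord_recl/= big1 ?addr0; last by move=> j _; rewrite uS0 ?mul0r.
by apply/eqP => h; apply: tc; rewrite -h mulrC mulKf.
Qed.

Variables (d : nat) (P : probability (pt R d * bool)%type R) (f : pt R d -> R).
Hypothesis hf : has_density P f.

Let set_fst (A : pt R d -> bool) :
  [set w : pt R d * bool | A w.1] = [set x | A x] `*` setT.
Proof. by apply/seteqP; split => -[x y] //= []. Qed.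

Lemma density_cube : P [set w | in_cube w.1] = 1%E.
Proof.
suff : P (~` [set w : pt R d * bool | in_cube w.1]) = 0%E.
  rewrite probability_setC; last first.
    rewrite set_fst; apply: measurableX => //.
    by apply: measurable_set_bool; exact: measurable_in_cube.
  move/eqP; rewrite sube_eq ?add0e; first by move=> /eqP <-.
    by [].
  by rewrite fin_num_adde_defr.
rewrite (_ : ~` _ = [set x | ~~ in_cube x] `*` setT); last first.
  by apply/seteqP; split => -[x y] /=; [move=> /negP|move=> [/negP]].
rewrite hf; last first.
  by apply: measurable_set_bool; apply: measurable_neg; exact: measurable_in_cube.
apply: cube_iter_eq0 => v v01; rewrite indicE memNset ?mulr0//=; apply/negP.
by rewrite negbK; apply/in_cubeP => i; rewrite tnth_mktuple; apply: v01.
Qed.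

Lemma density_bisector (a b : pt R d) : a <> b ->
  P [set w | dist2 w.1 a == dist2 w.1 b] = 0%E.
Proof.
move=> ab; rewrite (set_fst (fun x => dist2 x a == dist2 x b)) hf; last first.
  by apply: measurable_set_bool; apply: measurable_fun_eqr; exact: measurable_dist2.
(* The squares of the coordinates of [x] cancel in [dist2 x a = dist2 x b], leaving the equation of
   a hyperplane whose normal is nonzero since [a <> b]. *)
apply: (@cube_iter_hyperplane _ (fun i => 2 * (nth 0 a i - nth 0 b i))
  (\sum_(i < d) (tnth a i ^+ 2 - tnth b i ^+ 2))).
  apply: contrapT => h; apply: ab; apply: eq_from_tnth => i.
  apply/eqP/negPn/negP => abi; apply: h; exists i => //.
  by rewrite mulf_neq0// -!tnth_nth subr_eq0.
move=> v v01 hv; rewrite indicE memNset ?mulr0//= => /eqP h.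
move/negP: hv; apply; rewrite -subr_eq0; set x := mktuple _ in h.
rewrite (_ : _ - _ = - (dist2 x a - dist2 x b)); first by rewrite h subrr oppr0.
rewrite /dist2 -!sumrB -sumrN; apply: eq_bigr => i _.
by rewrite tnth_mktuple -!tnth_nth; ring.
Qed.

(** The point [b] lies on the bisector of its translates by [(1,...,1)] and [(-1,...,-1)], which are
    distinct when [d] is positive. *)
Lemma density_atom (b : pt R d) : (0 < d)%N -> P [set w | w.1 == b] = 0%E.
Proof.
move=> hd; pose e (s : R) : pt R d := mktuple (fun i => tnth b i + s).
apply: (@subset_measure0 _ _ _ _ _ [set w | dist2 w.1 (e 1) == dist2 w.1 (e (-1))]).
- rewrite (_ : [set w | _] = [set w | dist2 w.1 b <= 0]); last first.
    apply/seteqP; split => -[x y] /=.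
      by move=> /eqP ->; rewrite /dist2 big1// => i _; rewrite subrr expr0n.
    by move=> h; apply/eqP/dist2_eq0/eqP; rewrite eq_le h dist2_ge0.
  rewrite (set_fst (fun x => dist2 x b <= 0)); apply: measurableX => //.
  apply: measurable_set_bool; apply: measurable_fun_ler => //.
  exact: measurable_dist2.
- rewrite (set_fst (fun x => dist2 x (e 1) == dist2 x (e (-1)))).
  apply: measurableX => //; apply: measurable_set_bool.
  by apply: measurable_fun_eqr; exact: measurable_dist2.
- move=> [x y] /= /eqP ->; apply/eqP; apply: eq_bigr => i _.
  by rewrite !tnth_mktuple; ring.
- apply: density_bisector => h.
  have := congr1 (fun t => tnth t (Ordinal hd)) h; rewrite !tnth_mktuple.
  by lra.
Qed.

End Density.

(** * Scatter of a cell *)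

(** Here [m1], [m2] are the masses of the children, [T1], [T2] the integrals of the affine function
    [side] over them, and [sg] its mean over the parent. With [m = m1 + m2], the shift [tau]
    maximizes [4 * tau * g * k * m - tau ^+ 2 * D * m]. *)
Lemma split_gain_arith (R : realFieldType)
    (g k D m1 m2 T1 T2 sg u2 w1 w2 V1 V2 : R) (tau := 2 * g * k / D) :
  0 < g -> 0 < k -> 0 < D -> 0 <= m1 -> 0 <= m2 -> u2 <= D ->
  T1 + T2 = sg * (m1 + m2) ->
  g * k * (m1 + m2) <= T1 -> g * k * (m1 + m2) <= - T2 ->
  w1 <= V1 - 2 * tau * (T1 - sg * m1) + tau ^+ 2 * u2 * m1 ->
  w2 <= V2 - 2 * (- tau) * (T2 - sg * m2) + (- tau) ^+ 2 * u2 * m2 ->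
  w1 + w2 <= V1 + V2 - 4 * g ^+ 2 * k ^+ 2 / D * (m1 + m2).
Proof.
move=> g0 k0 D0 m10 m20 u2D; set m := m1 + m2 => mean S1 S2.
have m0 : 0 <= m by rewrite addr_ge0.
set gk := g * k in S1 S2 *; have gk0 : 0 < gk by rewrite mulr_gt0.
(* Multiplying by [m] and using the mean identity eliminates [sg], leaving
   [2 * m2 * T1 - 2 * m1 * T2]; zero mass is treated apart. *)
have bracket : 2 * gk * m <= (T1 - sg * m1) - (T2 - sg * m2).
  have [m00|mn0] := eqVneq m 0.
    have [m1z m2z] : m1 = 0 /\ m2 = 0 by rewrite /m in m00; split; lra.
    rewrite m00 m1z m2z !mulr0 !subr0; rewrite m00 !mulr0 in S1 S2; lra.
  have mp : 0 < m by rewrite lt_neqAle eq_sym mn0.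
  rewrite -(ler_pM2l mp).
  have -> : m * ((T1 - sg * m1) - (T2 - sg * m2)) = 2 * m2 * T1 - 2 * m1 * T2.
    rewrite (_ : _ * _ = m * (T1 - T2) - (sg * m) * (m1 - m2)); last by ring.
    by rewrite -mean /m; ring.
  have e1 : m2 * (gk * m) <= m2 * T1 by rewrite ler_wpM2l.
  have e2 : m1 * (gk * m) <= m1 * - T2 by rewrite ler_wpM2l.
  have -> : m * (2 * gk * m) = 2 * (m2 * (gk * m)) + 2 * (m1 * (gk * m)).
    by rewrite {1}/m; ring.
  by lra.
have tau0 : 0 < tau by rewrite divr_gt0// mulr_gt0// mulr_gt0.
have gain : 2 * tau * (2 * gk * m) <=
    2 * tau * ((T1 - sg * m1) - (T2 - sg * m2)).
  by rewrite ler_wpM2l// mulr_ge0// ltW.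
have cost : tau ^+ 2 * u2 * m <= tau ^+ 2 * D * m.
  by rewrite ler_wpM2r// ler_wpM2l// sqr_ge0.
have -> : 4 * g ^+ 2 * k ^+ 2 / D * m = 2 * tau * (2 * gk * m) - tau ^+ 2 * D * m.
  by rewrite /tau /gk; field; rewrite gt_eqF.
rewrite sqrrN; have -> : tau ^+ 2 * u2 * m1 = tau ^+ 2 * u2 * m - tau ^+ 2 * u2 * m2.
  by rewrite /m; ring.
by move=> h1 h2; lra.
Qed.

Section CellIntegral.
Variables (R : realType) (d : nat) (P : probability (pt R d * bool)%type R).
Local Notation pt := (pt R d).
Implicit Types (x y a b c : pt) (A B : pt -> bool) (f g : pt -> R).

Definition cell A := measurable_fun setT A /\ forall x, A x -> in_cube x.

(** Boundedness on the cube alone admits coordinates and squared distances, and suffices for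
    integrating over cells. *)
Definition cube_bm f := measurable_fun setT f /\
  exists M : R, forall x, in_cube x -> `|f x| <= M.

Definition cint A f : R := Ex P (fun w => (A w.1)%:R * f w.1).

Definition mass A : R := cint A (fun=> 1).

Lemma cube_bm_cst (r : R) : cube_bm (fun=> r).
Proof. by split => //; exists `|r|. Qed.

Lemma cube_bmD f g : cube_bm f -> cube_bm g -> cube_bm (fun x => f x + g x).
Proof.
move=> [mf [M fM]] [mg [N gN]]; split; first exact: measurable_funD.
exists (M + N) => x x01; apply: le_trans (ler_normD _ _) _.
by apply: lerD; [exact: fM|exact: gN].
Qed.

Lemma cube_bmM f g : cube_bm f -> cube_bm g -> cube_bm (fun x => f x * g x).
Proof.
move=> [mf [M fM]] [mg [N gN]]; split; first exact: measurable_funM.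
by exists (M * N) => x x01; rewrite normrM; apply: ler_pM => //; [exact: fM|exact: gN].
Qed.

Lemma cube_bmZ (r : R) f : cube_bm f -> cube_bm (fun x => r * f x).
Proof. by move=> bf; apply: cube_bmM => //; exact: cube_bm_cst. Qed.

Lemma cube_bmB f g : cube_bm f -> cube_bm g -> cube_bm (fun x => f x - g x).
Proof.
move=> bf bg; rewrite (_ : (fun x => _) = (fun x => f x + (-1) * g x)).
  by apply: cube_bmD => //; exact: cube_bmZ.
by apply/funext => x; rewrite mulN1r.
Qed.

Lemma cube_bm_sum (I : Type) (s : seq I) (F : I -> pt -> R) :
  (forall i, cube_bm (F i)) -> cube_bm (fun x => \sum_(i <- s) F i x).
Proof.
move=> bF; elim: s => [|i s IH].
  by under eq_fun do rewrite big_nil; exact: cube_bm_cst.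
by under eq_fun do rewrite big_cons; exact: cube_bmD.
Qed.

Lemma cube_bm_coord (i : 'I_d) : cube_bm (fun x => tnth x i).
Proof.
split; first exact: measurable_coord.
by exists 1 => x /in_cubeP/(_ i)/andP[x0 x1]; rewrite ger0_norm.
Qed.

Lemma cube_bm_dist2 c : cube_bm (fun x => dist2 x c).
Proof.
apply: cube_bm_sum => i; under eq_fun do rewrite expr2.
by apply: cube_bmM; apply: cube_bmB;
  [exact: cube_bm_coord|exact: cube_bm_cst|exact: cube_bm_coord|exact: cube_bm_cst].
Qed.

Lemma measurable_on_fst (d1 : measure_display) (U : measurableType d1)
    (h : pt -> U) :
  measurable_fun setT h -> measurable_fun setT (fun w : pt * bool => h w.1).
Proof. by move=> mh; exact: (measurableT_comp mh (@measurable_fst _ _ _ _)). Qed.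

Lemma bm_cell A f : cell A -> cube_bm f ->
  bm (fun w : pt * bool => (A w.1)%:R * f w.1).
Proof.
move=> [mA A01] [mf [M fM]]; split.
  apply: measurable_funM; last exact: measurable_on_fst.
  have [+ _] := @bm_ind _ _ R (fun w : pt * bool => A w.1) (measurable_on_fst mA).
  by [].
exists `|M| => -[x y] /=; case: (boolP (A x)) => [/A01 x01|_].
  by rewrite mul1r; apply: le_trans (fM _ x01) (ler_norm _).
by rewrite mul0r normr0.
Qed.

Lemma cellI A B : cell A -> measurable_fun setT B -> cell (fun x => A x && B x).
Proof.
move=> [mA A01] mB; split; first exact: measurable_and.
by move=> x /andP[/A01].
Qed.

Section Linear.
Variable A : pt -> bool.
Hypothesis cA : cell A.

Lemma cintD f g : cube_bm f -> cube_bm g ->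
  cint A (fun x => f x + g x) = cint A f + cint A g.
Proof.
move=> bf bg; rewrite /cint -ExD; [|exact: bm_cell..].
by apply: Ex_ext => w; rewrite mulrDr.
Qed.

Lemma cintZ (r : R) f : cube_bm f -> cint A (fun x => r * f x) = r * cint A f.
Proof.
move=> bf; rewrite /cint -ExZ; last exact: bm_cell.
by apply: Ex_ext => w; rewrite mulrCA.
Qed.

Lemma cintB f g : cube_bm f -> cube_bm g ->
  cint A (fun x => f x - g x) = cint A f - cint A g.
Proof.
move=> bf bg; rewrite /cint -ExB; [|exact: bm_cell..].
by apply: Ex_ext => w; rewrite mulrBr.
Qed.

Lemma cint_cst (r : R) : cint A (fun=> r) = r * mass A.
Proof.
rewrite /mass -cintZ; last exact: cube_bm_cst.
by congr cint; apply/funext => x; rewrite mulr1.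
Qed.

Lemma cint_sum (I : Type) (s : seq I) (F : I -> pt -> R) :
  (forall i, cube_bm (F i)) ->
  cint A (fun x => \sum_(i <- s) F i x) = \sum_(i <- s) cint A (F i).
Proof.
move=> bF; rewrite /cint -Ex_sum; last by move=> i; exact: bm_cell.
by apply: Ex_ext => w; rewrite mulr_sumr.
Qed.

Lemma cint_le f g : cube_bm f -> cube_bm g -> (forall x, A x -> f x <= g x) ->
  cint A f <= cint A g.
Proof.
move=> bf bg fg; apply: Ex_le => [||w]; [exact: bm_cell..|].
by case: (boolP (A w.1)) => [/fg|_]; rewrite ?mul1r ?mul0r.
Qed.

Lemma cint_ge0 f : (forall x, A x -> 0 <= f x) -> 0 <= cint A f.
Proof.
move=> f0; apply: Ex_ge0 => w.
by case: (boolP (A w.1)) => [/f0|_]; rewrite ?mul1r ?mul0r.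
Qed.

Lemma mass_ge0 : 0 <= mass A. Proof. by apply: cint_ge0. Qed.

Lemma cint_split B f : measurable_fun setT B -> cube_bm f ->
  cint A f = cint (fun x => A x && B x) f + cint (fun x => A x && ~~ B x) f.
Proof.
move=> mB bf; rewrite /cint -ExD; last 2 first.
- exact: (bm_cell (cellI cA mB) bf).
- exact: (bm_cell (cellI cA (measurable_neg mB)) bf).
apply: Ex_ext => w; rewrite -mulrDl; congr (_ * _).
by case: (A w.1); case: (B w.1); rewrite /= ?addr0 ?add0r.
Qed.

Lemma mass_split B : measurable_fun setT B ->
  mass A = mass (fun x => A x && B x) + mass (fun x => A x && ~~ B x).
Proof. by move=> mB; apply: cint_split => //; exact: cube_bm_cst. Qed.

End Linear.

Lemma cint_sub A B f : cell A -> cell B -> cube_bm f ->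
  (forall x, A x -> B x) -> (forall x, B x -> 0 <= f x) -> cint A f <= cint B f.
Proof.
move=> cA cB bf AB f0; apply: Ex_le => [||w]; [exact: bm_cell..|].
case: (boolP (A w.1)) => [/AB Bw|_]; first by rewrite Bw.
rewrite mul0r; case: (boolP (B w.1)) => [/f0 fw|_]; last by rewrite mul0r.
by rewrite mul1r.
Qed.

Lemma mass_sub A B : cell A -> cell B -> (forall x, A x -> B x) ->
  mass A <= mass B.
Proof. by move=> cA cB AB; apply: cint_sub => //; exact: cube_bm_cst. Qed.

Lemma mass_gt0_ex A : 0 < mass A -> exists x, A x.
Proof.
move=> m0; apply: contrapT => nA; move: m0.
rewrite /mass /cint (_ : (fun w => _) = (fun=> 0)) ?Ex_cst ?ltxx//.
apply/funext => w; case: (boolP (A w.1)) => [Aw|]; last by rewrite mul0r.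
by case: nA; exists w.1.
Qed.

Lemma mass_ind A : mass A = Ex P (ind R (fun w => A w.1)).
Proof. by apply: Ex_ext => w; rewrite mulr1. Qed.

Lemma mass_P A : cell A -> P [set w | A w.1] = (mass A)%:E.
Proof.
move=> [mA _]; rewrite mass_ind.
by rewrite (@Ex_ind _ _ _ P (fun w => A w.1))//; exact: measurable_on_fst.
Qed.

(** * First moments, center and scatter *)

Definition mom A (i : 'I_d) : R := cint A (fun x => tnth x i).

Definition center A : pt := mktuple (fun i => mom A i / mass A).

Definition scat A c : R := cint A (fun x => dist2 x c).

Definition W A : R := scat A (center A).

Lemma W_ge0 A : 0 <= W A.
Proof. by apply: cint_ge0 => x _; exact: dist2_ge0. Qed.

Lemma mass0_mom A (i : 'I_d) : cell A -> mass A = 0 -> mom A i = 0.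
Proof.
move=> cA m0; apply/eqP; rewrite eq_le; apply/andP; split.
  rewrite -m0; apply: cint_le => //; [exact: cube_bm_coord|exact: cube_bm_cst|].
  by move=> x /(cA.2)/in_cubeP/(_ i)/andP[].
by apply: cint_ge0 => x /(cA.2)/in_cubeP/(_ i)/andP[].
Qed.

(** For zero mass the quotient defining the center is 0 by convention, and the identity survives
    because the moment vanishes as well. *)
Lemma mass_center A (i : 'I_d) : cell A ->
  mass A * tnth (center A) i = mom A i.
Proof.
move=> cA; rewrite tnth_mktuple; have [m0|m0] := eqVneq (mass A) 0.
  by rewrite mass0_mom// m0 mul0r.
by rewrite mulrCA divff// mulr1.
Qed.

(** Parallel axis theorem: expanding about the center leaves a linear term whose integral is
    zero. *)
Lemma scat_shift A c : cell A -> scat A c = W A + mass A * dist2 (center A) c.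
Proof.
move=> cA; set m := center A.
pose lin x := \sum_(i < d) (2 * (tnth m i - tnth c i)) * (tnth x i - tnth m i).
have blin : cube_bm lin.
  apply: cube_bm_sum => i; apply: cube_bmZ; apply: cube_bmB.
    exact: cube_bm_coord.
  exact: cube_bm_cst.
have lin0 : cint A lin = 0.
  rewrite cint_sum//; last first.
    move=> i; apply: cube_bmZ; apply: cube_bmB;
    [exact: cube_bm_coord|exact: cube_bm_cst].
  apply: big1 => i _; rewrite cintZ//; last first.
    by apply: cube_bmB; [exact: cube_bm_coord|exact: cube_bm_cst].
  rewrite cintB//; [|exact: cube_bm_coord|exact: cube_bm_cst].
  by rewrite cint_cst// mulrC (mulrC _ (mass A)) mass_center// subrr mul0r.
rewrite /scat (_ : (fun x => _) =
    (fun x => (dist2 x m + lin x) + dist2 m c)); last first.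
  apply/funext => x; rewrite /dist2 /lin -!big_split/=; apply: eq_bigr => i _.
  by ring.
rewrite cintD//; [|by apply: cube_bmD => //; exact: cube_bm_dist2
                  |exact: cube_bm_cst].
rewrite cintD//; last exact: cube_bm_dist2.
by rewrite lin0 addr0 cint_cst// mulrC.
Qed.

Lemma W_le_scat A c : cell A -> W A <= scat A c.
Proof.
by move=> cA; rewrite scat_shift// lerDl mulr_ge0 ?mass_ge0 ?dist2_ge0.
Qed.

(** The scatter of the parent is the sum of the scatters of both parts about the parent's center,
    and recentering each part can only lower its scatter. *)
Lemma W_split_le A B : cell A -> measurable_fun setT B ->
  W (fun x => A x && B x) + W (fun x => A x && ~~ B x) <= W A.
Proof.
move=> cA mB; rewrite {3}/W /scat.
have -> := cint_split cA mB (cube_bm_dist2 (center A)).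
apply: lerD; apply: W_le_scat; first exact: cellI.
by apply: cellI => //; exact: measurable_neg.
Qed.

Lemma W_le_mass A : cell A -> W A <= d%:R * mass A.
Proof.
move=> cA; have [m0|m0] := eqVneq (mass A) 0.
  apply: le_trans (W_le_scat (Z0 R d 0%N) cA) _.
  rewrite -cint_cst//; apply: cint_le => //; [exact: cube_bm_dist2|exact: cube_bm_cst|].
  move=> x Ax; apply: dist2_le_cube; first exact: cA.2.
  by apply/in_cubeP => i; rewrite tnth_mktuple lexx ler01.
have mp : 0 < mass A by rewrite lt_neqAle eq_sym m0 mass_ge0.
have [x Ax] := mass_gt0_ex mp.
apply: le_trans (W_le_scat x cA) _.
rewrite -cint_cst//; apply: cint_le => //; [exact: cube_bm_dist2|exact: cube_bm_cst|].
by move=> y Ay; apply: dist2_le_cube; exact: cA.2.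
Qed.

Lemma dist2_shift x c u (tau : R) :
  dist2 x (mktuple (fun i => tnth c i + tau * tnth u i)) =
  dist2 x c - 2 * tau * \sum_(i < d) (tnth x i - tnth c i) * tnth u i +
  tau ^+ 2 * \sum_(i < d) tnth u i ^+ 2.
Proof.
rewrite /dist2 !mulr_sumr -sumrB -big_split/=; apply: eq_bigr => i _.
by rewrite tnth_mktuple; ring.
Qed.

(** Half the difference of squared distances is affine in [x] with gradient [a - b]; its sign tells
    which pivot is closer. *)
Definition side a b x : R := (dist2 x b - dist2 x a) / 2.

Lemma side_affine a b x c :
  \sum_(i < d) (tnth x i - tnth c i) * (tnth a i - tnth b i) =
  side a b x - side a b c.
Proof.
rewrite /side -mulrBl /dist2 -!sumrB mulr_suml; apply: eq_bigr => i _; by field.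
Qed.

Lemma side_ge0 a b x : (0 <= side a b x) = (dist2 x a <= dist2 x b).
Proof. by rewrite /side pmulr_lge0 ?invr_gt0// subr_ge0. Qed.

Lemma cube_bm_side a b : cube_bm (side a b).
Proof.
rewrite /side; under eq_fun do rewrite mulrC.
by apply: cube_bmZ; apply: cube_bmB; exact: cube_bm_dist2.
Qed.

(* The centers of the two children are pushed along [a - b] by the optimal
   amount [tau]; the gain is the square of the resulting first-order term. *)
Lemma W_split A a b (Q1 Q2 : pt -> bool) (g kappa : R) :
  cell A -> in_cube a -> in_cube b -> (0 < d)%N ->
  measurable_fun setT Q1 -> measurable_fun setT Q2 -> 0 < g -> 0 < kappa ->
  (forall x, A x -> Q1 x -> g <= side a b x) ->
  (forall x, A x -> Q2 x -> side a b x <= - g) ->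
  kappa * mass A <= mass (fun x => A x && Q1 x) ->
  kappa * mass A <= mass (fun x => A x && Q2 x) ->
  W (fun x => A x && (dist2 x a <= dist2 x b)) +
  W (fun x => A x && ~~ (dist2 x a <= dist2 x b)) <=
  W A - 4 * g ^+ 2 * kappa ^+ 2 / d%:R * mass A.
Proof.
move=> cA a01 b01 hd mQ1 mQ2 g0 k0 s1 s2 k1 k2.
pose B x := dist2 x a <= dist2 x b.
have mB : measurable_fun setT B by apply: measurable_fun_ler; exact: measurable_dist2.
have mNB := measurable_neg mB.
set A1 := fun x => A x && B x; set A2 := fun x => A x && ~~ B x.
rewrite -[leLHS]/(W A1 + W A2).
have c1 : cell A1 by exact: cellI.
have c2 : cell A2 by exact: cellI.
have bs := cube_bm_side a b.
set c := center A; set sg := side a b c.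
pose u : pt := mktuple (fun i => tnth a i - tnth b i).
have D0 : (0 : R) < d%:R by rewrite ltr0n.
pose tau := 2 * g * kappa / d%:R.
pose u2 := \sum_(i < d) tnth u i ^+ 2.
have u2d : u2 <= d%:R.
  rewrite /u2 (_ : \sum_(i < d) _ = dist2 a b) ?dist2_le_cube//.
  by apply: eq_bigr => i _; rewrite tnth_mktuple.
(* Moving the reference point along [u] adds a term linear in [t], given by the integral of [side]
   relative to its value [sg] at the center, and a quadratic one. *)
have scE (A' : pt -> bool) (t : R) : cell A' ->
    scat A' (mktuple (fun i => tnth c i + t * tnth u i)) =
    scat A' c - 2 * t * (cint A' (side a b) - sg * mass A') + t ^+ 2 * u2 * mass A'.
  move=> cA'; rewrite /scat (_ : (fun x => _) = (fun x =>
      dist2 x c - 2 * t * (side a b x - sg) + t ^+ 2 * u2)); last first.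
    apply/funext => x; rewrite dist2_shift /sg -side_affine.
    suff -> : \sum_(i < d) (tnth x i - tnth c i) * tnth u i =
      \sum_(i < d) (tnth x i - tnth c i) * (tnth a i - tnth b i) by [].
    by apply: eq_bigr => i _; rewrite [tnth u i]tnth_mktuple.
  have b1 : cube_bm (fun x => side a b x - sg).
    by apply: cube_bmB => //; exact: cube_bm_cst.
  have b2 := cube_bm_dist2 c.
  rewrite cintD//; [|by apply: cube_bmB => //; exact: cube_bmZ|exact: cube_bm_cst].
  rewrite cintB//; last exact: cube_bmZ.
  rewrite cintZ// cintB//; last exact: cube_bm_cst.
  by rewrite !cint_cst.
(* An affine function integrates over [A] to its value at the center times the mass. *)
have mean_side : cint A (side a b) = sg * mass A.
  rewrite (_ : side a b = (fun x => sg + \sum_(i < d)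
     (tnth a i - tnth b i) * (tnth x i - tnth c i))); last first.
    apply/funext => x; under eq_bigr do rewrite mulrC.
    by rewrite side_affine /sg addrC subrK.
  have bl i : cube_bm (fun x => tnth x i - tnth c i).
    by apply: cube_bmB; [exact: cube_bm_coord|exact: cube_bm_cst].
  rewrite cintD//; [|exact: cube_bm_cst|by apply: cube_bm_sum => i; exact: cube_bmZ].
  rewrite cint_cst// cint_sum//; last by move=> i; exact: cube_bmZ.
  rewrite big1 ?addr0// => i _; rewrite cintZ// cintB//;
    [|exact: cube_bm_coord|exact: cube_bm_cst].
  by rewrite cint_cst// (mulrC _ (mass A)) mass_center// subrr mulr0.
have bd := cube_bm_dist2 c.
have bg := cube_bm_cst g.
have WA : W A = scat A1 c + scat A2 c by exact: cint_split.
have mA : mass A = mass A1 + mass A2 by exact: mass_split.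
have sA : cint A (side a b) = cint A1 (side a b) + cint A2 (side a b).
  exact: cint_split.
have h1 := W_le_scat (mktuple (fun i => tnth c i + tau * tnth u i)) c1.
have h2 := W_le_scat (mktuple (fun i => tnth c i + (- tau) * tnth u i)) c2.
rewrite scE// in h1; rewrite scE// in h2.
(* [side] is nonnegative on [A1], so its integral may be restricted to [Q1], where it is at least
   [g]. *)
have S1 : g * kappa * mass A <= cint A1 (side a b).
  have cQ : cell (fun x => A x && Q1 x) by exact: cellI.
  apply: (@le_trans _ _ (cint (fun x => A x && Q1 x) (fun=> g))).
    by rewrite cint_cst// -mulrA ler_pM2l.
  apply: (@le_trans _ _ (cint (fun x => A x && Q1 x) (side a b))).
    by apply: cint_le => // x /andP[]; exact: s1.
  apply: cint_sub => // x /andP[Ax].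
    move=> Qx; rewrite /A1 Ax /B/= -side_ge0.
    exact: le_trans (ltW g0) (s1 x Ax Qx).
  by rewrite /B -side_ge0.
have S2 : g * kappa * mass A <= - cint A2 (side a b).
  have cQ : cell (fun x => A x && Q2 x) by exact: cellI.
  have bs' : cube_bm (fun x => -1 * side a b x) by exact: cube_bmZ.
  rewrite -mulN1r -[leRHS](cintZ c2 _ bs).
  apply: (@le_trans _ _ (cint (fun x => A x && Q2 x) (fun=> g))).
    by rewrite cint_cst// -mulrA ler_pM2l.
  apply: (@le_trans _ _ (cint (fun x => A x && Q2 x) (fun x => -1 * side a b x))).
    by apply: cint_le => // x /andP[Ax Qx]; rewrite mulN1r lerNr; exact: s2.
  apply: cint_sub => // x /andP[Ax].
    move=> Qx; rewrite /A2 Ax /B/= -side_ge0 -ltNge.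
    by apply: le_lt_trans (s2 x Ax Qx) _; rewrite oppr_lt0.
  by rewrite /B -side_ge0 -ltNge mulN1r oppr_ge0 => /ltW.
rewrite sA mA in mean_side; rewrite mA in S1 S2 *; rewrite WA.
exact: (split_gain_arith g0 k0 D0 (mass_ge0 A1) (mass_ge0 A2) u2d mean_side
  S1 S2 h1 h2).
Qed.

End CellIntegral.

(** * Contraction of the scatter *)

Section Contraction.
Variables (R : realType) (d : nat) (P : probability (pt R d * bool)%type R).
Local Notation pt := (pt R d).
Implicit Types (x y a b c : pt) (A B C : pt -> bool).
Local Notation mass := (mass P).
Local Notation W := (W P).

Lemma mass_cover (I : finType) A (F : I -> pt -> bool) :
  cell A -> (forall j, measurable_fun setT (F j)) ->
  (forall x, A x -> exists j, F j x) ->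
  mass A <= \sum_j mass (fun x => A x && F j x).
Proof.
move=> cA mF Fcov; rewrite -Ex_sum; last first.
  by move=> j; exact: (bm_cell (cellI cA (mF j)) (cube_bm_cst d 1)).
apply: Ex_le => [||w]; first exact: (bm_cell cA (cube_bm_cst d 1)).
  by apply: bm_sum => j; exact: (bm_cell (cellI cA (mF j)) (cube_bm_cst d 1)).
case: (boolP (A w.1)) => [/[dup] Aw /Fcov[j Fj]|_] /=.
  rewrite mulr1 (bigD1 j)//= Fj mulr1 lerDl; apply: sumr_ge0 => i _.
  by rewrite mulr1.
by rewrite mul0r sumr_ge0// => i _; rewrite mul0r.
Qed.

Lemma mass_pigeonhole (I : finType) (j0 : I) A (F : I -> pt -> bool) :
  cell A -> (forall j, measurable_fun setT (F j)) ->
  (forall x, A x -> exists j, F j x) ->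
  exists j, mass A <= #|I|%:R * mass (fun x => A x && F j x).
Proof.
move=> cA mF Fcov.
case: (@Order.TotalTheory.arg_maxP _ _ I j0 xpredT
  (fun j => mass (fun x => A x && F j x)) isT) => j _ jmax.
exists j; apply: le_trans (mass_cover cA mF Fcov) _.
by rewrite mulr_natl -sumr_const; apply: ler_sum => i _; exact: jmax.
Qed.

Lemma grid_mesh (v : R) : 0 < v -> exists M : nat,
  forall (j : {ffun 'I_d -> 'I_M.+1}) x y, box j x -> box j y ->
    36 * dist2 x y <= v.
Proof.
move=> v0; pose M := (Num.truncn (36 * d%:R / v)).+1.
have Mlt : 36 * d%:R / v < M%:R by exact: truncnS_gt.
exists M => j x y jx jy; have h := box_diam jx jy.
have M1 : (1 : R) <= M%:R by rewrite ler1n.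
have M20 : (0 : R) < M%:R ^+ 2 by rewrite exprn_gt0// ltr0n.
rewrite ltr_pdivrMr// in Mlt.
rewrite -(ler_pM2l M20).
have : M%:R * v <= M%:R ^+ 2 * v by rewrite ler_pM2r// expr2 ler_peMl.
by lra.
Qed.

(** Pigeonhole gives a first heavy box; let [c] be a point of [A] in it. Points within squared
    distance [v / 2] of [c] account for at most half of [v * mass A], and the others contribute at
    most [d] per unit of mass. The far part therefore has a fixed fraction of the mass, and
    pigeonhole inside it gives the second box. *)
Lemma heavy_separated_boxes (v : R) : (0 < d)%N -> 0 < v ->
  exists (M : nat) (kappa : R), 0 < kappa /\
  forall A, cell A -> 0 < mass A -> v * mass A <= W A ->
  exists j1 j2 : {ffun 'I_d -> 'I_M.+1},
  [/\ kappa * mass A <= mass (fun x => A x && box j1 x),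
      kappa * mass A <= mass (fun x => A x && box j2 x) &
      forall a b, box j1 a -> box j2 b -> forall x,
        (box j1 x -> v / 24 <= side a b x) /\
        (box j2 x -> side a b x <= - (v / 24))].
Proof.
move=> hd v0; have [M mesh] := grid_mesh v0.
pose I := {ffun 'I_d -> 'I_M.+1}; pose N : R := #|{: I}|%:R.
pose j0 : I := [ffun=> ord0].
have N0 : 0 < N by rewrite ltr0n; apply/card_gt0P; exists j0.
have D0 : (0 : R) < d%:R by rewrite ltr0n.
have mbox (j : I) : measurable_fun setT (box j) by exact: measurable_box.
pose k1 := N^-1; pose k2 := v / (2 * d%:R) / N.
have k10 : 0 < k1 by rewrite invr_gt0.
have k20 : 0 < k2 by rewrite divr_gt0// divr_gt0// mulr_gt0.
exists M, (Num.min k1 k2); split; first by rewrite lt_min k10.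
move=> A cA mA WA.
have [j1 hj1] : exists j : I, mass A <= N * mass (fun x => A x && box j x).
  by apply: mass_pigeonhole => // x /(cA.2); exact: box_cover.
have m1 : k1 * mass A <= mass (fun x => A x && box j1 x) by rewrite ler_pdivrMl.
have [c /andP[Ac c1]] : exists c, A c && box j1 c.
  by apply: (mass_gt0_ex (P := P)); apply: lt_le_trans m1; rewrite mulr_gt0.
have c01 := cA.2 _ Ac.
pose far x := v / 2 < dist2 x c.
have mfar : measurable_fun setT far.
  by apply: measurable_fun_ltr => //; exact: measurable_dist2.
have cfar : cell (fun x => A x && far x) by exact: cellI.
have cnear : cell (fun x => A x && ~~ far x).
  by apply: cellI => //; exact: measurable_neg.
have scA : v * mass A <= scat P A c by exact: le_trans WA (W_le_scat P c cA).
have bd := @cube_bm_dist2 R d c.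
have hfar : scat P (fun x => A x && far x) c <= d%:R * mass (fun x => A x && far x).
  rewrite -cint_cst//; apply: cint_le => //; first exact: cube_bm_cst.
  by move=> x /andP[/(cA.2) x01 _]; exact: dist2_le_cube.
have hnear : scat P (fun x => A x && ~~ far x) c <= v / 2 * mass A.
  apply: (@le_trans _ _ (v / 2 * mass (fun x => A x && ~~ far x))).
    rewrite -cint_cst//; apply: cint_le => //; first exact: cube_bm_cst.
    by move=> x /andP[_]; rewrite -leNgt.
  rewrite ler_pM2l ?divr_gt0//; apply: mass_sub => //.
  by move=> x /andP[].
have mfar_ge : v / (2 * d%:R) * mass A <= mass (fun x => A x && far x).
  have e : scat P A c = scat P (fun x => A x && far x) c +
    scat P (fun x => A x && ~~ far x) c by exact: cint_split.
  rewrite e in scA.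
  have -> : v / (2 * d%:R) * mass A = (v / 2 * mass A) / d%:R.
    by field; rewrite gt_eqF.
  rewrite ler_pdivrMr// mulrC.
  move: scA hfar hnear; move: (scat P _ c) (scat P _ c) (mass _) (mass _).
  by move=> *; lra.
have [j2 hj2] : exists j : I, mass (fun x => A x && far x) <=
    N * mass (fun x => (A x && far x) && box j x).
  by apply: mass_pigeonhole => // x /(cfar.2); exact: box_cover.
have m2' : k2 * mass A <= mass (fun x => (A x && far x) && box j2 x).
  rewrite /k2 mulrAC ler_pdivrMr// [leRHS]mulrC.
  exact: le_trans mfar_ge hj2.
have [y /andP[/andP[Ay fy] y2]] : exists y, (A y && far y) && box j2 y.
  by apply: (mass_gt0_ex (P := P)); apply: lt_le_trans m2'; rewrite mulr_gt0.
have m2 : k2 * mass A <= mass (fun x => A x && box j2 x).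
  apply: le_trans m2' _; apply: mass_sub; [exact: cellI|exact: cellI|].
  by move=> x /andP[/andP[-> _] ->].
exists j1, j2; split.
- by apply: le_trans m1; rewrite ler_wpM2r ?ge_min ?lexx// ltW.
- by apply: le_trans m2; rewrite ler_wpM2r ?ge_min ?lexx ?orbT// ltW.
(* Squared diameters are at most [v / 36], so [dist2_tri3] gives [v / 2 <= 3 * (v / 36 + dist2 p q +
   v / 36)], hence [v / 9]. Then [side] is at least [(v / 9 - v / 36) / 2 = v / 24] on the first
   box. *)
have sep p q : box j1 p -> box j2 q -> v / 9 <= dist2 p q.
  move=> jp jq; have := mesh _ _ _ c1 jp; have := mesh _ _ _ jq y2.
  have := dist2_tri3 c p q y; move: fy; rewrite /far (dist2C y c).
  move: (dist2 c y) (dist2 c p) (dist2 p q) (dist2 q y) v0; clear.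
  by move=> *; lra.
move=> a b ja jb x; rewrite /side; split => jx.
  have := sep _ _ jx jb; have := mesh _ _ _ jx ja.
  move: (dist2 x b) (dist2 x a) v0; clear; by move=> *; lra.
have := sep _ _ ja jx; have := mesh _ _ _ jx jb; rewrite (dist2C a x).
move: (dist2 x b) (dist2 x a) v0; clear; by move=> *; lra.
Qed.

(** Pivots are drawn in the closed cell [C], while the scatter is measured on its half-open version
    [A]. The gain is kept as [beta] times one indicator per pivot, so that each draw integrates an
    explicit simple function; the ratios are the probabilities of hitting [Q1] and [Q2]. *)
Lemma W_contraction (v : R) : (0 < d)%N -> 0 < v ->
  exists lam : R, [/\ 0 < lam, lam < 1 &
  forall A C, cell A -> cell C -> (forall x, A x -> C x) ->
    0 < mass C -> mass A = mass C ->
  exists (Q1 Q2 : pt -> bool) (beta : R),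
  [/\ measurable_fun setT Q1, measurable_fun setT Q2, 0 <= beta <= W A,
    (forall a b, in_cube a -> in_cube b ->
      W (fun x => A x && (dist2 x a <= dist2 x b)) +
      W (fun x => A x && ~~ (dist2 x a <= dist2 x b)) <=
      W A - beta * (Q1 a)%:R * (Q2 b)%:R) &
    lam * (W A - v * mass A) <= beta *
      (mass (fun x => C x && Q1 x) / mass C) *
      (mass (fun x => C x && Q2 x) / mass C)]].
Proof.
move=> hd v0; have [M [kappa [k0 boxes]]] := heavy_separated_boxes hd v0.
have D0 : (0 : R) < d%:R by rewrite ltr0n.
pose g := v / 24; have g0 : 0 < g by rewrite divr_gt0.
pose gam := 4 * g ^+ 2 * kappa ^+ 2 / d%:R.
have gam0 : 0 < gam by rewrite divr_gt0// !mulr_gt0// exprn_gt0.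
(* The factor [1 / d] converts mass into scatter through [W_le_mass]; the minimum with [1 / 2] keeps
   [lam] below 1. *)
pose lam := Num.min (gam * kappa ^+ 2 / d%:R) (1 / 2).
have lam0 : 0 < lam.
  by rewrite lt_min !divr_gt0// mulr_gt0// exprn_gt0.
have mB a b : measurable_fun setT (fun x => dist2 x a <= dist2 x b).
  by apply: measurable_fun_ler; exact: measurable_dist2.
exists lam; split => //.
  by rewrite gt_min; apply/orP; right; rewrite ltr_pdivrMr// mul1r ltr1n.
(* Below the threshold the left side of the last bound is nonpositive, and [beta = 0] will do. *)
move=> A C cA cC AC mC mAC; case: (ltP (W A) (v * mass A)) => WA.
  exists (fun=> true), (fun=> true), 0; split => //.
  - by rewrite lexx W_ge0.
  - move=> a b _ _.
    rewrite !mul0r [leRHS]subr0.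
    exact: (W_split_le P cA (mB a b)).
  - by rewrite !mul0r mulr_ge0_le0 ?(ltW lam0)// subr_le0 ltW.
have mA : 0 < mass A by rewrite mAC.
have [j1 [j2 [m1 m2 sep]]] := boxes A cA mA WA.
have mQ1 : measurable_fun setT (box (R := R) j1) by exact: measurable_box.
have mQ2 : measurable_fun setT (box (R := R) j2) by exact: measurable_box.
have dec a b : in_cube a -> in_cube b -> box j1 a -> box j2 b ->
    W (fun x => A x && (dist2 x a <= dist2 x b)) +
    W (fun x => A x && ~~ (dist2 x a <= dist2 x b)) <= W A - gam * mass A.
  move=> a01 b01 ja jb; apply: (@W_split _ _ P A a b (box j1) (box j2)) => //.
    by move=> x _ jx; exact: (sep a b ja jb x).1.
  by move=> x _ jx; exact: (sep a b ja jb x).2.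
exists (box j1), (box j2), (gam * mass A); split => //.
(* Some pair of pivots realizes the decrease, and the scatter remaining after it is nonnegative, so
   [beta] is at most [W A]. *)
- rewrite mulr_ge0 ?(ltW gam0) ?(ltW mA)//=.
  have [a /andP[Aa ja]] : exists a, A a && box j1 a.
    by apply: (mass_gt0_ex (P := P)); apply: lt_le_trans m1; rewrite mulr_gt0.
  have [b /andP[Ab jb]] : exists b, A b && box j2 b.
    by apply: (mass_gt0_ex (P := P)); apply: lt_le_trans m2; rewrite mulr_gt0.
  rewrite -subr_ge0; apply: le_trans (dec _ _ (cA.2 _ Aa) (cA.2 _ Ab) ja jb).
  exact: addr_ge0 (W_ge0 P _) (W_ge0 P _).
- move=> a b a01 b01.
  case: (boolP (box j1 a)) => ja; last first.
    rewrite mulr0 mul0r [leRHS]subr0.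
    exact: (W_split_le P cA (mB a b)).
  case: (boolP (box j2 b)) => jb; last first.
    rewrite mulr0 [leRHS]subr0.
    exact: (W_split_le P cA (mB a b)).
  by rewrite !mulr1; exact: dec.
- have ratio (Q : pt -> bool) : measurable_fun setT Q ->
      kappa * mass A <= mass (fun x => A x && Q x) ->
      kappa <= mass (fun x => C x && Q x) / mass C.
    move=> mQ h; rewrite ler_pdivlMr// -mAC; apply: le_trans h _.
    apply: mass_sub; [exact: cellI|exact: cellI|].
    by move=> x /andP[/AC -> ->].
  have r1 := ratio _ mQ1 m1; have r2 := ratio _ mQ2 m2.
  apply: (@le_trans _ _ (gam * mass A * kappa * kappa)); last first.
    have gm : 0 <= gam * mass A by rewrite mulr_ge0 ?ltW.
    have k0' := ltW k0.
    apply: ler_pM => //; first by rewrite mulr_ge0.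
    by rewrite ler_wpM2l.
  apply: (@le_trans _ _ (lam * (d%:R * mass A))).
    rewrite ler_pM2l//; apply: le_trans (W_le_mass P cA).
    by rewrite lerBlDr lerDl mulr_ge0 ?ltW.
  apply: (@le_trans _ _ (gam * kappa ^+ 2 / d%:R * (d%:R * mass A))).
    by rewrite ler_wpM2r ?ge_min ?lexx// mulr_ge0 ?ltW.
  rewrite le_eqVlt; apply/orP; left; apply/eqP; field.
  by rewrite gt_eqF.
Qed.

End Contraction.

(** * Expectation over the tree *)

Lemma split_pot_arith (R : realDomainType) (r K q v rest be s t w w1 w2 m1 m2 : R) :
  0 <= K -> 0 <= q -> w1 + w2 <= w - be * s * t ->
  r + K * (rest + (q * w1 + v * (1 - q) * m1) + (q * w2 + v * (1 - q) * m2)) <=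
  r + K * (rest + q * w + v * (1 - q) * (m1 + m2)) - K * q * be * s * t.
Proof.
move=> K0 q0 h; rewrite -subr_ge0.
rewrite (_ : _ - _ = K * (q * (w - be * s * t - (w1 + w2)))); last by ring.
by rewrite !mulr_ge0// subr_ge0.
Qed.

(** The two sides differ by [K * q] times the gap in the contraction inequality; averaging over both
    pivots thus raises the exponent of [1 - lam] by one. *)
Lemma contract_pot_arith (R : realDomainType)
    (r K q v lam rest be r1 r2 w m : R) :
  0 <= K -> 0 <= q -> lam * (w - v * m) <= be * r1 * r2 ->
  r + K * (rest + q * w + v * (1 - q) * m) - K * q * be * r2 * r1 <=
  r + K * (((1 - lam) * q * w + v * (1 - (1 - lam) * q) * m) + rest).
Proof.
move=> K0 q0 h; rewrite -subr_ge0.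
rewrite (_ : _ - _ = K * (q * (be * r1 * r2 - lam * (w - v * m)))); last by ring.
by rewrite !mulr_ge0// subr_ge0.
Qed.

Lemma trunc_log2_doubleS (k : nat) : (0 < k)%N ->
  trunc_log 2 (2 * k).+1 = (trunc_log 2 k).+1.
Proof.
move=> k0; rewrite trunc_log2S; last lia.
by congr (trunc_log 2 _).+1; lia.
Qed.

Section Tree.
Variables (R : realType) (d : nat) (P : probability (pt R d * bool)%type R).
Local Notation pt := (pt R d).
Implicit Types (x y a b c : pt) (A B C H : pt -> bool) (Z : nat -> pt).
Local Notation mass := (mass P).
Local Notation W := (W P).

Lemma cell_in_cell Z (k : nat) : cell (in_cell Z k).
Proof.
split; first exact: measurable_in_cell.
by move=> x; rewrite in_cellE; exact: gcell_cube.
Qed.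

Lemma cell_hcell Z (k : nat) : cell (hcell Z k).
Proof. by split; [exact: measurable_hcell|move=> x; exact: gcell_cube]. Qed.

Lemma cond_int_ge0 C (G : pt -> \bar R) :
  (forall x, (0 <= G x)%E) -> (0 <= cond_int P C G)%E.
Proof.
move=> G0; apply: mule_ge0.
  by apply: integral_ge0 => w _; apply: mule_ge0 => //; rewrite lee_fin.
by rewrite lee_fin invr_ge0 fine_ge0.
Qed.

(** A majorant affine in the indicator of [Q] has an explicit conditional expectation, the indicator
    becoming a conditional probability. Exceptional pivots are collected in [N]. *)
Lemma cond_int_le C (N : set (pt * bool)) (G : pt -> \bar R) (Q : pt -> bool)
    (al be : R) :
  cell C -> 0 < mass C -> measurable N -> P N = 0%E -> measurable_fun setT Q ->
  (forall x, (0 <= G x)%E) ->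
  (forall w, ~ N w -> C w.1 -> (G w.1 <= (al - be * (Q w.1)%:R)%:E)%E) ->
  (cond_int P C G <= (al - be * (mass (fun x => C x && Q x) / mass C))%:E)%E.
Proof.
move=> cC mC mN N0 mQ G0 GQ; rewrite /cond_int mass_P//=.
have bQ : cube_bm (fun x => (Q x)%:R : R).
  have [mi [M iM]] := bm_ind R mQ; split => //.
  by exists M => x _; exact: iM.
have b1 := cube_bm_cst d al; have b2 := cube_bmZ be bQ.
have bg := bm_cell cC (cube_bmB b1 b2).
have -> : (al - be * (mass (fun x => C x && Q x) / mass C))%:E =
  ((cint P C (fun x => al - be * (Q x)%:R))%:E * (mass C)^-1%:E)%E.
  rewrite -EFinM cintB// cintZ// cint_cst//.
  have -> : cint P C (fun x => (Q x)%:R) = mass (fun x => C x && Q x).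
    apply: Ex_ext => w; rewrite mulr1.
    by case: (C w.1); case: (Q w.1); rewrite /= ?mulr1 ?mulr0.
  by congr EFin; field; rewrite gt_eqF.
apply: lee_wpmul2r; first by rewrite lee_fin invr_ge0 ltW.
apply: (lower_integral_le_ae mN N0 bg) => [w|w Nw].
  by apply: mule_ge0 => //; rewrite lee_fin.
case: (boolP (C w.1)) => Cw; last by rewrite mule0 mul0r.
by rewrite mule1 mul1r; exact: GQ.
Qed.

Lemma cond_int_ge C (N : set (pt * bool)) (G : pt -> \bar R) (al : R) :
  cell C -> 0 < mass C -> measurable N -> P N = 0%E -> 0 <= al ->
  (forall x, (0 <= G x)%E) ->
  (forall w, ~ N w -> C w.1 -> (al%:E <= G w.1)%E) ->
  (al%:E <= cond_int P C G)%E.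
Proof.
move=> cC mC mN N0 al0 G0 GQ; rewrite /cond_int mass_P//=.
have bg := bm_cell cC (cube_bm_cst d al).
have -> : al%:E = ((cint P C (fun=> al))%:E * (mass C)^-1%:E)%E.
  rewrite -EFinM cint_cst//.
  by congr EFin; rewrite mulfK// gt_eqF.
apply: lee_wpmul2r; first by rewrite lee_fin invr_ge0 ltW.
apply: (lower_integral_ge_ae mN N0 bg) => [w|w|w Nw].
- by rewrite mulr_ge0.
- by apply: mule_ge0 => //; rewrite lee_fin.
case: (boolP (C w.1)) => Cw; last by rewrite mule0 mul0r.
by rewrite mule1 mul1r; exact: GQ.
Qed.

Lemma tree_int_ge0 (fuel k : nat) Z (F : (nat -> pt) -> \bar R) :
  (forall Z, (0 <= F Z)%E) -> (0 <= tree_int P fuel k Z F)%E.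
Proof.
move=> F0; elim: fuel k Z => [|fuel IH] k Z //=.
by apply: cond_int_ge0 => a; exact: cond_int_ge0.
Qed.

Lemma negligible_fin_bigsetU (I : finType) (F : I -> set (pt * bool)) :
  (forall i, P.-negligible (F i)) -> P.-negligible (\big[setU/set0]_i F i).
Proof.
move=> nF; apply: (big_ind (fun S => P.-negligible S)) => //.
  exact: negligible_set0.
by move=> S S'; exact: negligibleU.
Qed.

Lemma mass_null A : cell A -> P [set w | A w.1] = 0%E -> mass A = 0.
Proof. by move=> cA; rewrite mass_P// => -[]. Qed.

(* Almost every point of [C] lies in its support. *)
Lemma support_null C : cell C -> exists N : set (pt * bool),
  [/\ measurable N, P N = 0%E & forall w, ~ N w -> C w.1 ->
    forall (M : nat) (j : {ffun 'I_d -> 'I_M.+1}), box j w.1 ->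
      0 < mass (fun x => C x && box j x)].
Proof.
move=> cC.
(* There are countably many boxes over all meshes, so the massless pieces that they cut from [C]
   have a null union. *)
pose F (M : nat) (j : {ffun 'I_d -> 'I_M.+1}) : set (pt * bool) :=
  if mass (fun x => C x && box j x) == 0 then [set w | C w.1 && box j w.1] else set0.
have cB M (j : {ffun 'I_d -> 'I_M.+1}) : cell (fun x => C x && box j x).
  by apply: cellI => //; exact: measurable_box.
have nF M j : P.-negligible (@F M j).
  rewrite /F; case: eqP => [m0|_]; last exact: negligible_set0.
  exists [set w | C w.1 && box j w.1]; split => //.
    apply: measurable_set_bool.
    by apply: (measurable_on_fst (h := fun x => C x && box j x)); case: (cB M j).
  have -> := mass_P P (cB M j).
  by congr EFin.
have : P.-negligible (\bigcup_M \big[setU/set0]_j @F M j).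
  by apply: negligible_bigcup => M; exact: negligible_fin_bigsetU.
move=> [N [mN N0 sN]]; exists N; split => // w Nw Cw M j jw.
rewrite lt_neqAle mass_ge0 andbT eq_sym; apply/negP => m0; apply: Nw; apply: sN.
by exists M => //; rewrite (bigD1 j)//=; left; rewrite /F m0 /= Cw.
Qed.

(** Both parts of [H] are dominated by those of [C] and the totals agree, so neither inequality can
    be strict. *)
Lemma mass_eq_sub H C B : cell H -> cell C -> (forall x, H x -> C x) ->
  mass H = mass C -> measurable_fun setT B ->
  mass (fun x => H x && B x) = mass (fun x => C x && B x).
Proof.
move=> cH cC HC HCm mB.
have mNB := measurable_neg mB.
have h1 := mass_split P cH mB; have h2 := mass_split P cC mB.
have le1 : mass (fun x => H x && B x) <= mass (fun x => C x && B x).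
  apply: mass_sub; [exact: (cellI cH mB)|exact: (cellI cC mB)|].
  by move=> x /andP[/HC -> ->].
have le2 : mass (fun x => H x && ~~ B x) <= mass (fun x => C x && ~~ B x).
  apply: mass_sub; [exact: (cellI cH mNB)|exact: (cellI cC mNB)|].
  by move=> x /andP[/HC -> ->].
move: h1 h2 le1 le2; rewrite HCm.
move: (mass _) (mass _) (mass _) (mass _) (mass _) => *; lra.
Qed.

(** * Nondegeneracy of the cells along the random tree *)

Hypothesis Pcube : P [set w | in_cube w.1] = 1%E.
Hypothesis Pbis : forall a b, a <> b ->
  P [set w | dist2 w.1 a == dist2 w.1 b] = 0%E.
Hypothesis Patom : forall b, P [set w | w.1 == b] = 0%E.

(* Nodes [k .. 2k-1] are the unprocessed nodes whose parent is processed. *)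
Definition frontier_ok (k : nat) Z := forall m, (k <= m < 2 * k)%N ->
  0 < mass (in_cell Z m) /\ mass (hcell Z m) = mass (in_cell Z m).

(** The two sets differ only on the bisector, which is null. *)
Lemma mass_tie C a b : cell C -> a <> b ->
  mass (fun x => C x && (dist2 x b <= dist2 x a)) =
  mass (fun x => C x && ~~ (dist2 x a <= dist2 x b)).
Proof.
move=> cC ab.
have mB p q : measurable_fun setT (fun x => dist2 x p <= dist2 x q).
  by apply: measurable_fun_ler; exact: measurable_dist2.
have cB := cellI cC (mB b a).
rewrite (mass_split P cB (mB a b)).
set A1 := fun x => _ && (dist2 x a <= dist2 x b).
have c1 : cell A1 := cellI cB (mB a b).
have -> : mass A1 = 0.
  apply: mass_null => //.
  apply: (subset_measure0 _ _ _ (Pbis ab)).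
  - apply: measurable_set_bool.
    by apply: (measurable_on_fst (h := A1)); case: c1.
  - apply: measurable_set_bool.
    apply: (measurable_on_fst (h := fun x => dist2 x a == dist2 x b)).
    by apply: measurable_fun_eqr; exact: measurable_dist2.
  - by move=> w /= /andP[/andP[_ h1] h2]; rewrite eq_le h1 h2.
rewrite add0r; congr mass; apply/funext => x.
by case: (C x) => //=; rewrite -ltNge; case: ltgtP.
Qed.

(** When [a] is in the support of [C], a whole box around it lies on its side and carries mass of
    [C]. *)
Lemma mass_closer_gt0 C a b : cell C -> a <> b ->
  (forall (M : nat) (j : {ffun 'I_d -> 'I_M.+1}), box j a ->
      0 < mass (fun x => C x && box j x)) -> in_cube a ->
  0 < mass (fun x => C x && (dist2 x a <= dist2 x b)).
Proof.
move=> cC ab supp a01; have [M sep] := box_separation ab.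
have [j ja] := box_cover M a01.
apply: lt_le_trans (supp M j ja) _; apply: mass_sub.
- by apply: cellI => //; exact: measurable_box.
- by apply: cellI => //; apply: measurable_fun_ler; exact: measurable_dist2.
- by move=> x /andP[-> jx]; exact: ltW (sep j x ja jx).
Qed.

(** A split can degenerate in two ways: a pivot outside the support of the cell, excluded by [N], or
    two equal pivots. Node [k] leaves the frontier, and its two children enter it. *)
Lemma frontier_step (k : nat) Z : (0 < k)%N -> frontier_ok k Z ->
  exists N : set (pt * bool), [/\ measurable N, P N = 0%E &
    forall wa wb, ~ N wa -> ~ N wb -> in_cell Z k wa.1 -> in_cell Z k wb.1 ->
      wa.1 <> wb.1 -> frontier_ok k.+1 (upd2 Z k wa.1 wb.1)].
Proof.
move=> k0 ok; have cC := cell_in_cell Z k; have cH := cell_hcell Z k.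
have [N [mN N0 supp]] := support_null cC.
have [|_ mHC] := ok k; first lia.
exists N; split => // wa wb Na Nb Ca Cb; set a := wa.1; set b := wb.1 => ab.
have mB p q : measurable_fun setT (fun x => dist2 x p <= dist2 x q).
  by apply: measurable_fun_ler; exact: measurable_dist2.
have HC x : hcell Z k x -> in_cell Z k x by exact: hcell_in_cell.
move=> m mk; have [m2k|] := ltnP m (2 * k).
  have -> : in_cell (upd2 Z k a b) m = in_cell Z m.
    by apply/funext => x; rewrite in_cell_upd_lt.
  have -> : hcell (upd2 Z k a b) m = hcell Z m.
    by apply/funext => x; rewrite hcell_upd_lt.
  by apply: ok; lia.
move=> km; have [->|->] : m = (2 * k)%N \/ m = (2 * k).+1 by lia.
  have -> : in_cell (upd2 Z k a b) (2 * k) =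
      (fun x => in_cell Z k x && (dist2 x a <= dist2 x b)).
    by apply/funext => x; rewrite in_cell_upd0// andbC.
  have -> : hcell (upd2 Z k a b) (2 * k) =
      (fun x => hcell Z k x && (dist2 x a <= dist2 x b)).
    by apply/funext => x; rewrite hcell_upd0// andbC.
  split; last by apply: mass_eq_sub.
  by apply: mass_closer_gt0 => //; [exact: supp|exact: cC.2].
have -> : in_cell (upd2 Z k a b) (2 * k).+1 =
    (fun x => in_cell Z k x && (dist2 x b <= dist2 x a)).
  by apply/funext => x; rewrite in_cell_upd1// andbC.
have -> : hcell (upd2 Z k a b) (2 * k).+1 =
    (fun x => hcell Z k x && ~~ (dist2 x a <= dist2 x b)).
  by apply/funext => x; rewrite hcell_upd1// andbC.
split.
  apply: mass_closer_gt0 => //; [exact: nesym|exact: supp|exact: cC.2].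
rewrite mass_tie//.
exact: (mass_eq_sub cH cC HC mHC (measurable_neg (mB a b))).
Qed.

Lemma frontier_root Z : frontier_ok 1 Z.
Proof.
move=> m m1; have -> : m = 1%N by lia.
have -> : in_cell Z 1 = @in_cube R d by apply/funext => x; rewrite in_cellE gcell1.
have -> : hcell Z 1 = @in_cube R d by apply/funext => x; rewrite /hcell gcell1.
split => //; rewrite -lte_fin -mass_P; first by rewrite Pcube lte_fin.
by split; [exact: measurable_in_cube|].
Qed.

Lemma null_atom (N : set (pt * bool)) b : measurable N -> P N = 0%E ->
  measurable (N `|` [set w | w.1 == b]) /\ P (N `|` [set w | w.1 == b]) = 0%E.
Proof.
move=> mN N0.
have mb : measurable [set w : pt * bool | w.1 == b].
  rewrite (_ : [set w | _] = [set w : pt * bool | dist2 w.1 b <= 0]); last first.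
    apply/seteqP; split => -[x y] /=.
      by move=> /eqP ->; rewrite /dist2 big1// => i _; rewrite subrr expr0n.
    by move=> h; apply/eqP/dist2_eq0/eqP; rewrite eq_le h dist2_ge0.
  apply: measurable_set_bool.
  apply: (measurable_on_fst (h := fun x => dist2 x b <= 0)).
  by apply: measurable_fun_ler => //; exact: measurable_dist2.
split; first exact: measurableU.
by rewrite measureU0//; exact: Patom.
Qed.

(** Conditioning on a cell of positive mass is a probability, so each draw preserves the bound [r];
    at zero mass the convention for inverses would turn the expectation into 0. *)
Lemma tree_int_ge (fuel k : nat) Z (F : (nat -> pt) -> \bar R) (r : R) :
  (0 < k)%N -> 0 <= r -> (forall Z, (r%:E <= F Z)%E) -> frontier_ok k Z ->
  (r%:E <= tree_int P fuel k Z F)%E.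
Proof.
move=> + r0 rF; have F0 Z' : (0 <= F Z')%E.
  by apply: le_trans (rF Z'); rewrite lee_fin.
elim: fuel k Z => [|fuel IH] k Z k0 ok //=.
have [N [mN N0 step]] := frontier_step k0 ok.
have cC := cell_in_cell Z k; have [|mC _] := ok k; first lia.
apply: (cond_int_ge cC mC mN N0 r0) => [a|wa Na Ca].
  by apply: cond_int_ge0 => b; exact: tree_int_ge0.
have [mN' N'0] := null_atom wa.1 mN N0.
apply: (cond_int_ge cC mC mN' N'0 r0) => [b|wb Nb Cb]; first exact: tree_int_ge0.
apply: IH => //; apply: step => //; first by move=> Nwb; apply: Nb; left.
by move=> ab; apply: Nb; right => /=; rewrite ab.
Qed.

(** * Upper bound on the expected scatter of the leaves *)

Section Upper.
Variables (v lam : R).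
Hypothesis lam1 : lam < 1.
Hypothesis contr : forall A C, cell A -> cell C -> (forall x, A x -> C x) ->
    0 < mass C -> mass A = mass C ->
  exists (Q1 Q2 : pt -> bool) (beta : R),
  [/\ measurable_fun setT Q1, measurable_fun setT Q2, 0 <= beta <= W A,
    (forall a b, in_cube a -> in_cube b ->
      W (fun x => A x && (dist2 x a <= dist2 x b)) +
      W (fun x => A x && ~~ (dist2 x a <= dist2 x b)) <=
      W A - beta * (Q1 a)%:R * (Q2 b)%:R) &
    lam * (W A - v * mass A) <= beta *
      (mass (fun x => C x && Q1 x) / mass C) *
      (mass (fun x => C x && Q2 x) / mass C)].
Variable p : nat.

(* Bound on the expected scatter below node [m], [p - trunc_log 2 m] levels
   further down. *)
Definition pot (m : nat) Z : R :=
  (1 - lam) ^+ (p - trunc_log 2 m) * W (hcell Z m) +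
  v * (1 - (1 - lam) ^+ (p - trunc_log 2 m)) * mass (hcell Z m).

(** Induction on the number of nodes left to split: the total [pot] over the frontier does not
    increase in expectation. The relation [fuel + k = 2 ^ p] makes the frontier coincide with level
    [p] when the fuel runs out. *)
Lemma tree_int_le (fuel k : nat) Z (F : (nat -> pt) -> \bar R) (r K : R) :
  (0 < k)%N -> (fuel + k)%N = (2 ^ p)%N -> 0 <= K ->
  (forall Z, (0 <= F Z)%E) ->
  (forall Z, (F Z <= (r + K * \sum_(2 ^ p <= m < 2 * 2 ^ p)
    W (hcell Z m))%:E)%E) ->
  frontier_ok k Z ->
  (tree_int P fuel k Z F <= (r + K * \sum_(k <= m < 2 * k) pot m Z)%:E)%E.
Proof.
move=> + + K0 F0 FW; elim: fuel k Z => [|fuel IH] k Z k0 fk ok /=.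
  rewrite add0n in fk; apply: le_trans (FW Z) _; rewrite -fk lee_fin.
  rewrite le_eqVlt; apply/orP; left; apply/eqP; congr (_ + _ * _).
  apply: eq_big_nat => m mk; rewrite /pot.
  (* At level [p] no contraction remains, and [pot] reduces to the scatter. *)
  have -> : (p - trunc_log 2 m = 0)%N.
    by apply/eqP; rewrite subn_eq0; apply: trunc_log_max => //; rewrite -fk; case/andP: mk.
  by rewrite expr0 mul1r subrr mulr0 mul0r [RHS]addr0.
have fkS : (fuel + k.+1)%N = (2 ^ p)%N by rewrite -fk addSnnS.
have k2 : (k < 2 * k)%N by rewrite mul2n -addnn -[ltnLHS]addn0 ltn_add2l.
have kp : (k < 2 ^ p)%N by rewrite -fkS leq_addl.
have [N [mN N0 step]] := frontier_step k0 ok.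
have cC := cell_in_cell Z k; have [|mC mHC] := ok k; first by rewrite leqnn.
have cH := cell_hcell Z k.
have [Q1 [Q2 [be [mQ1 mQ2 /andP[be0 beW] split_le gain]]]] :=
  contr cH cC (@hcell_in_cell _ _ Z k) mC mHC.
pose e := (p - (trunc_log 2 k).+1)%N; pose q := (1 - lam) ^+ e.
have q0 : 0 <= q by rewrite exprn_ge0// subr_ge0 ltW.
have tk : (trunc_log 2 k < p)%N.
  have := trunc_logP (isT : (1 < 2)%N) k0.
  by move=> /leq_ltn_trans => /(_ _ kp); rewrite ltn_exp2l.
have ek : (p - trunc_log 2 k = e.+1)%N by rewrite /e subnSK.
have e0 : (p - trunc_log 2 (2 * k) = e)%N by rewrite mul2n trunc_log2_double.
have e1 : (p - trunc_log 2 (2 * k).+1 = e)%N.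
  by rewrite trunc_log2_doubleS.
set rest := \sum_(k.+1 <= m < 2 * k) pot m Z.
pose S := rest + q * W (hcell Z k) + v * (1 - q) * mass (hcell Z k).
pose r1 := mass (fun x => in_cell Z k x && Q1 x) / mass (in_cell Z k).
pose r2 := mass (fun x => in_cell Z k x && Q2 x) / mass (in_cell Z k).
(* With both pivots fixed, only node [k] gives way to its children, and the decrease of scatter
   appears as a product of two indicators. *)
have inner wa wb : ~ N wa -> ~ N wb -> in_cell Z k wa.1 -> in_cell Z k wb.1 ->
    wa.1 <> wb.1 ->
    (tree_int P fuel k.+1 (upd2 Z k wa.1 wb.1) F <=
      (r + K * S - K * q * be * (Q1 wa.1)%:R * (Q2 wb.1)%:R)%:E)%E.
  move=> Na Nb Ca Cb ab; apply: le_trans.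
    by apply: (IH k.+1) => //; exact: step.
  set Z' := upd2 _ _ _ _.
  rewrite lee_fin (_ : (2 * k.+1 = (2 * k).+2)%N); last by rewrite !mul2n.
  rewrite big_nat_recr ?big_nat_recr//=; last exact: leqW.
  rewrite (_ : \sum_(k.+1 <= m < 2 * k) pot m Z' = rest); last first.
    apply: eq_big_nat => m mk; rewrite /pot.
    rewrite (_ : hcell Z' m = hcell Z m)//; apply/funext => x.
    by rewrite hcell_upd_lt//; case/andP: mk.
  have H0 : hcell Z' (2 * k) =
      (fun x => hcell Z k x && (dist2 x wa.1 <= dist2 x wb.1)).
    by apply/funext => x; rewrite hcell_upd0// andbC.
  have H1 : hcell Z' (2 * k).+1 =
      (fun x => hcell Z k x && ~~ (dist2 x wa.1 <= dist2 x wb.1)).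
    by apply/funext => x; rewrite hcell_upd1// andbC.
  have mB : measurable_fun setT (fun x : pt => dist2 x wa.1 <= dist2 x wb.1).
    by apply: measurable_fun_ler; exact: measurable_dist2.
  rewrite /pot e0 e1 -/q H0 H1 /S (mass_split P cH mB).
  exact: split_pot_arith K0 q0 (split_le wa.1 wb.1 (cC.2 _ Ca) (cC.2 _ Cb)).
(* Averaging over the second pivot replaces the indicator of [Q2] by its probability [r2]; the first
   pivot is then averaged likewise. *)
have inner2 wa : ~ N wa -> in_cell Z k wa.1 ->
    (cond_int P (in_cell Z k) (fun b => tree_int P fuel k.+1 (upd2 Z k wa.1 b) F)
     <= (r + K * S - K * q * be * r2 * (Q1 wa.1)%:R)%:E)%E.
  move=> Na Ca; have [mN' N'0] := null_atom wa.1 mN N0.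
  have -> : r + K * S - K * q * be * r2 * (Q1 wa.1)%:R =
     r + K * S - K * q * be * (Q1 wa.1)%:R * r2 by ring.
  apply: (cond_int_le cC mC mN' N'0 mQ2) => [b|wb Nb Cb]; first exact: tree_int_ge0.
  apply: inner => //; first by move=> Nwb; apply: Nb; left.
  by move=> ab; apply: Nb; right => /=; rewrite ab.
apply: (@le_trans _ _ (r + K * S - K * q * be * r2 * r1)%:E).
  apply: (cond_int_le cC mC mN N0 mQ1) => // a.
  by apply: cond_int_ge0 => b; exact: tree_int_ge0.
rewrite lee_fin big_ltn//.
rewrite -/rest /pot ek exprS -/q /S.
exact: contract_pot_arith K0 q0 gain.
Qed.

End Upper.

End Tree.

(** * Partitions of small scatter *)

Lemma min_le_addr (R : realDomainType) (a a' b b' c c' : R) :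
  0 <= b -> 0 <= c -> 0 <= b' -> 0 <= c' -> a <= b + c -> a' <= b' -> a' <= c' ->
  Num.min a a' <= Num.min b b' + Num.min c c'.
Proof.
move=> b0 c0 b'0 c'0 h h1 h2; rewrite ge_min.
case: (leP b b') => hb; case: (leP c c') => hc; apply/orP; [left|right..]; lra.
Qed.

Lemma min_le_shift (R : realDomainType) (a b c e : R) :
  0 <= e -> a <= c + e -> Num.min a b <= Num.min c b + e.
Proof.
by move=> e0 h; rewrite ge_min; case: (leP c b) => cb; apply/orP; [left|right]; lra.
Qed.

Section GoodSets.
Variables (R : realType) (d : nat) (P : probability (pt R d * bool)%type R).
Local Notation pt := (pt R d).
Implicit Types (x y c : pt).
Local Notation mass := (mass P).
Local Notation W := (W P).

Let bm_fst (B : pt -> bool) : measurable_fun setT B ->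
  bm (fun w : pt * bool => (B w.1)%:R * (1 : R)).
Proof.
move=> mB; have := bm_ind R (measurable_on_fst mB).
by rewrite /ind; under [in X in _ -> X]eq_fun do rewrite mulr1.
Qed.

Lemma mass_splitT (B C : pt -> bool) : measurable_fun setT B ->
  measurable_fun setT C ->
  mass B = mass (fun x => B x && C x) + mass (fun x => B x && ~~ C x).
Proof.
move=> mB mC; rewrite /mass /cint -ExD; last 2 first.
- exact: (bm_fst (measurable_and mB mC)).
- exact: (bm_fst (measurable_and mB (measurable_neg mC))).
apply: Ex_ext => w; rewrite !mulr1.
by case: (B w.1); case: (C w.1); rewrite /= ?addr0 ?add0r.
Qed.

Lemma mass_subT (B C : pt -> bool) : measurable_fun setT B ->
  measurable_fun setT C -> (forall x, B x -> C x) -> mass B <= mass C.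
Proof.
move=> mB mC BC; apply: Ex_le => [||w]; [exact: bm_fst..|].
rewrite !mulr1; case: (boolP (B w.1)) => [/BC ->|_] //.
Qed.

Lemma mass_exhaust (B : nat -> pt -> bool) (Boo : pt -> bool) (eps : R) :
  (forall n, measurable_fun setT (B n)) -> measurable_fun setT Boo ->
  (forall n x, B n x -> B n.+1 x) ->
  (forall x, Boo x <-> exists n, B n x) -> 0 < eps ->
  exists n, mass (fun x => Boo x && ~~ B n x) <= eps.
Proof.
move=> mB mBoo Bnd BE eps0.
pose S n := [set w : pt * bool | B n w.1].
have mS n : measurable (S n).
  by apply: measurable_set_bool; exact: measurable_on_fst.
have SE : \bigcup_n S n = [set w | Boo w.1].
  apply/seteqP; split => [w [n _ Snw]|w /BE[n Bn]]; last by exists n.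
  by apply/BE; exists n.
have cv : P \o S @ \oo --> P (\bigcup_n S n).
  apply: nondecreasing_cvg_mu => //; first exact: bigcup_measurable.
  move=> m n mn; apply/subsetPset => w; rewrite /S /=.
  move: mn; elim: n => [|n IH]; first by rewrite leqn0 => /eqP ->.
  by rewrite leq_eqVlt => /predU1P[->//|]; rewrite ltnS => /IH h /h /Bnd.
have PE (C : pt -> bool) : measurable_fun setT C ->
    P [set w | C w.1] = (mass C)%:E.
  move=> mC; rewrite mass_ind.
  by rewrite (@Ex_ind _ _ _ P (fun w => C w.1))//; exact: measurable_on_fst.
rewrite SE PE// in cv; have /fine_cvgP[_ {}cv] := cv.
have /cvgrPdist_le/(_ _ eps0)[n _ /(_ n (leqnn n))] := cv.
rewrite /= /S PE//= => h; exists n; apply: le_trans h.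
rewrite (mass_splitT mBoo (mB n)).
rewrite (_ : (fun x => Boo x && B n x) = B n); last first.
  apply/funext => x; apply: andb_idl => Bx; by apply/BE; exists n.
by rewrite [X in `|X|]addrAC subrr add0r ler_norm.
Qed.

Definition disjoint_cells (A : nat -> pt -> bool) :=
  (forall k, cell (A k)) /\ forall j k x, A j x -> A k x -> j = k.

Lemma sum_mass_disjoint (A : nat -> pt -> bool) (s : seq nat) (B : pt -> bool) :
  disjoint_cells A -> uniq s -> measurable_fun setT B ->
  \sum_(k <- s) mass (fun x => A k x && B x) <= mass B.
Proof.
move=> [cA dA] us mB; rewrite /mass /cint -Ex_sum; last first.
  by move=> k; exact: (bm_fst (measurable_and (cA k).1 mB)).
apply: Ex_le => [||w]; last 1 first.
- elim: s us => [|k s IH] /=; first by rewrite big_nil mulr1.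
  move=> /andP[ks us]; rewrite big_cons.
  case: (boolP (A k w.1)) => Ak /=; last by rewrite mul0r add0r; exact: IH.
  rewrite big_seq big1 ?addr0// => j js; case: (boolP (A j w.1)) => Aj /=.
    by move: ks; rewrite (dA k j _ Ak Aj) js.
  by rewrite mul0r.
- by apply: bm_sum => k; exact: (bm_fst (measurable_and (cA k).1 mB)).
- exact: bm_fst.
Qed.

(** Least mass misclassified on [A] when membership in [B] is guessed by a constant. *)
Definition min_mass (A : pt -> bool) (B : set pt) :=
  Num.min (mass (fun x => A x && (x \in B))) (mass (fun x => A x && (x \notin B))).

(* Every partition with small total scatter nearly determines membership in
   [B], uniformly over partitions. *)
Definition good (B : set pt) := measurable B /\
  forall eps : R, 0 < eps -> exists2 K : R, 0 <= K &
  forall (A : nat -> pt -> bool) (s : seq nat), disjoint_cells A -> uniq s ->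
    \sum_(k <- s) min_mass (A k) B <= eps + K * \sum_(k <- s) W (A k).

Lemma goodC B : good B -> good (~` B).
Proof.
move=> [mB gB]; split; first exact: measurableC.
move=> eps /gB[K K0 h]; exists K => // A s dA us.
apply: le_trans (h A s dA us); rewrite le_eqVlt; apply/orP; left; apply/eqP.
apply: eq_bigr => k _; rewrite /min_mass minC; congr Num.min; congr mass;
  by apply/funext => x; rewrite in_setC ?negbK.
Qed.

Lemma min_massU A B C : cell A -> measurable B -> measurable C ->
  min_mass A (B `|` C) <= min_mass A B + min_mass A C.
Proof.
move=> cA mB mC.
have mm D : measurable D -> measurable_fun setT (fun x : pt => x \in D).
  exact: measurable_mem.
have cI D : measurable D -> cell (fun x => A x && (x \in D)).
  by move=> mD; apply: cellI => //; exact: mm.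
have cN D : measurable D -> cell (fun x => A x && (x \notin D)).
  by move=> mD; apply: cellI => //; apply: measurable_neg; exact: mm.
have mBC := measurableU _ _ mB mC.
have h1 : mass (fun x => A x && (x \notin B `|` C)) <=
    mass (fun x => A x && (x \notin B)).
  apply: mass_sub; [exact: cN|exact: cN|].
  by move=> x /andP[->]; rewrite in_setU negb_or => /andP[].
have h2 : mass (fun x => A x && (x \notin B `|` C)) <=
    mass (fun x => A x && (x \notin C)).
  apply: mass_sub; [exact: cN|exact: cN|].
  by move=> x /andP[->]; rewrite in_setU negb_or => /andP[].
have h3 : mass (fun x => A x && (x \in B `|` C)) <=
    mass (fun x => A x && (x \in B)) + mass (fun x => A x && (x \in C)).
  rewrite (mass_splitT (cI _ mBC).1 (mm _ mB)); apply: lerD; apply: mass_sub.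
  - exact: (cellI (cI _ mBC) (mm _ mB)).
  - exact: cI.
  - by move=> x /andP[/andP[-> _] ->].
  - exact: (cellI (cI _ mBC) (measurable_neg (mm _ mB))).
  - exact: cI.
  - move=> x /andP[/andP[-> +] /negbTE xB]; by rewrite in_setU xB.
have p1 := mass_ge0 P (fun x => A x && (x \in B)).
have p2 := mass_ge0 P (fun x => A x && (x \in C)).
have p3 := mass_ge0 P (fun x => A x && (x \notin B)).
have p4 := mass_ge0 P (fun x => A x && (x \notin C)).
exact: min_le_addr.
Qed.

Lemma goodU B C : good B -> good C -> good (B `|` C).
Proof.
move=> [mB gB] [mC gC]; split; first exact: measurableU.
move=> eps eps0; have e2 : 0 < eps / 2 by rewrite divr_gt0.
have [K K0 hB] := gB _ e2; have [L L0 hC] := gC _ e2.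
exists (K + L); first exact: addr_ge0.
move=> A s dA us.
apply: le_trans (_ : \sum_(k <- s) (min_mass (A k) B + min_mass (A k) C) <= _).
  by apply: ler_sum => k _; apply: min_massU => //; exact: dA.1.
rewrite big_split/= mulrDl; have := hB A s dA us; have := hC A s dA us.
move: (\sum_(_ <- _) _) (\sum_(_ <- _) _) (K * _) (L * _) => *; lra.
Qed.

(** The part of a cell in [B] is covered by its part in [C] and its part in [B] minus [C]; over
    disjoint cells the latter adds up to at most [eps]. This serves both countable unions and
    half-spaces. *)
Lemma good_approx B : measurable B ->
  (forall eps : R, 0 < eps -> exists C (K : R), [/\ measurable C, 0 <= K,
     mass (fun x => (x \in B) && (x \notin C)) <= eps &
     forall (A : nat -> pt -> bool) (s : seq nat), disjoint_cells A -> uniq s ->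
      \sum_(k <- s) Num.min (mass (fun x => A k x && (x \in C)))
        (mass (fun x => A k x && (x \notin B))) <=
        eps + K * \sum_(k <- s) W (A k)]) -> good B.
Proof.
move=> mB h; split=> // eps eps0; have e2 : 0 < eps / 2 by rewrite divr_gt0.
have [C [K [mC K0 small hK]]] := h _ e2.
exists K => // A s dA us.
pose D x := (x \in B) && (x \notin C).
have mmB := measurable_mem mB; have mmC := measurable_mem mC.
have mD : measurable_fun setT D by apply: measurable_and => //; exact: measurable_neg.
apply: le_trans (_ : \sum_(k <- s) (Num.min (mass (fun x => A k x && (x \in C)))
  (mass (fun x => A k x && (x \notin B))) + mass (fun x => A k x && D x)) <= _).
  apply: ler_sum => k _; have cA := dA.1 k.
  apply: min_le_shift; first exact: mass_ge0.
  have cB := cellI cA mmB.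
  rewrite (mass_splitT cB.1 mmC); apply: lerD; apply: mass_sub.
  - exact: (cellI cB mmC).
  - exact: cellI.
  - by move=> x /andP[/andP[-> _] ->].
  - exact: (cellI cB (measurable_neg mmC)).
  - exact: cellI.
  - by move=> x /andP[/andP[-> xB] xC]; rewrite /D xB.
rewrite big_split/=.
have := hK A s dA us; have := le_trans (sum_mass_disjoint dA us mD) small.
move: (\sum_(_ <- _) _) (\sum_(_ <- _) _) (K * _) => *; lra.
Qed.

Lemma good0 : good set0.
Proof.
split; first exact: measurable0.
move=> eps eps0; exists 0 => // A s dA us; rewrite mul0r addr0.
rewrite big1 ?ltW// => k _; rewrite /min_mass.
have -> : mass (fun x => A k x && (x \in set0)) = 0.
  rewrite /mass /cint -[RHS](Ex_cst P 0); apply: Ex_ext => w.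
  by rewrite in_set0 andbF mul0r.
by rewrite min_l// mass_ge0.
Qed.

(** Finite unions exhaust the countable one in mass, and their complements contain its complement,
    so goodness of a finite union bounds the mixed minimum. *)
Lemma good_bigcup (F : nat -> set pt) :
  (forall n, good (F n)) -> good (\bigcup_n F n).
Proof.
move=> gF; have mF n : measurable (F n) by case: (gF n).
have mU : measurable (\bigcup_n F n) by exact: bigcup_measurable.
have gS n : good (\big[setU/set0]_(i < n) F i).
  elim: n => [|n IH]; first by rewrite big_ord0; exact: good0.
  by rewrite big_ord_recr/=; exact: goodU.
apply: good_approx => // eps eps0.
pose B n (x : pt) := x \in \big[setU/set0]_(i < n) F i.
have [n hn] : exists n, mass (fun x => (x \in \bigcup_n F n) && ~~ B n x) <= eps.
  apply: (@mass_exhaust B) => //.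
  - by move=> n; apply: measurable_mem; case: (gS n).
  - exact: measurable_mem.
  - by move=> n x; rewrite /B big_ord_recr/= in_setU => ->.
  - move=> x; rewrite inE; split => [[n _ Fn]|[n]].
      by exists n.+1; rewrite /B big_ord_recr/= in_setU orbC mem_set.
    by rewrite /B inE -bigcup_mkord => -[i _ Fi]; exists i.
have [mC gC] := gS n; have [K K0 hK] := gC _ eps0.
exists (\big[setU/set0]_(i < n) F i), K; split => // A s dA us.
apply: le_trans (hK A s dA us); apply: ler_sum => k _; rewrite /min_mass.
have cA := dA.1 k; apply: le_min2 => //.
apply: mass_sub; [apply: (cellI cA); apply: measurable_neg; exact: measurable_mem..|].
move=> x /andP[-> /=]; apply: contra; rewrite !inE -bigcup_mkord.
by move=> [i _ Fi]; exists i.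
Qed.

(** Chebyshev's inequality in one coordinate about the center. *)
Lemma W_coord (A B : pt -> bool) (i : 'I_d) (del : R) : cell A ->
  measurable_fun setT B -> 0 < del ->
  (forall x, B x -> del <= (tnth x i - tnth (center P A) i) ^+ 2) ->
  mass (fun x => A x && B x) <= del^-1 * W A.
Proof.
move=> cA mB del0 h; rewrite ler_pdivlMl//.
have cB := cellI cA mB.
have bd := cube_bm_dist2 (center P A).
rewrite -cint_cst//.
apply: (@le_trans _ _ (cint P (fun x => A x && B x) (fun x => dist2 x (center P A)))).
  apply: cint_le => //; first exact: cube_bm_cst.
  move=> x /andP[_ Bx]; apply: le_trans (h x Bx) _.
  by rewrite /dist2 (bigD1 i)//= lerDl sumr_ge0// => j _; exact: sqr_ge0.
by apply: cint_sub => // [x /andP[]//|x _]; exact: dist2_ge0.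
Qed.

(** A gap of small mass is left between [t] and [t + del]. In coordinate [i], the center of a cell
    is at distance at least [del / 2] from one of the two remaining sides, whose mass in the cell is
    then controlled by the scatter. *)
Lemma good_ray (i : 'I_d) (t : R) : good [set x | t < tnth x i].
Proof.
have mray (u : R) : measurable_fun setT (fun x : pt => u < tnth x i).
  by apply: measurable_fun_ltr => //; exact: measurable_coord.
have mset (u : R) : measurable [set x : pt | u < tnth x i].
  exact: measurable_set_bool.
apply: good_approx => // eps eps0.
have memE (u : R) (x : pt) : (x \in [set x : pt | u < tnth x i]) = (u < tnth x i).
  by apply/idP/idP; rewrite inE.
have [n hn] : exists n : nat, mass (fun x : pt =>
    (t < tnth x i) && ~~ (t + n.+1%:R^-1 < tnth x i)) <= eps.
  apply: (@mass_exhaust (fun n x => t + n.+1%:R^-1 < tnth x i)) => //.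
    move=> n x; apply: le_lt_trans; rewrite lerD2l lef_pV2 ?posrE ?ltr0n//.
    by rewrite ler_nat.
  move=> x; split => [tx|[n]]; last by apply: lt_trans; rewrite ltrDl invr_gt0 ltr0n.
  exists (Num.truncn (tnth x i - t)^-1); rewrite -ltrBrDl.
  rewrite invf_plt ?posrE ?ltr0n// ?subr_gt0//; exact: truncnS_gt.
set del : R := n.+1%:R^-1 in hn.
have del0 : 0 < del by rewrite invr_gt0 ltr0n.
pose d4 := (del / 2) ^+ 2; have d40 : 0 < d4 by rewrite exprn_gt0// divr_gt0.
exists [set x | t + del < tnth x i], d4^-1; split => //.
- by rewrite invr_ge0 ltW.
- by under eq_fun do rewrite !memE.
move=> A s dA us; rewrite mulr_sumr; apply: le_trans (ler_wpDl (ltW eps0) (lexx _)).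
apply: ler_sum => k _; have cA := dA.1 k.
under eq_fun do rewrite memE; under [in X in Num.min _ X]eq_fun do rewrite memE.
set c := tnth (center P (A k)) i.
rewrite ge_min; case: (leP c (t + del / 2)) => ct; apply/orP; [left|right].
  apply: (W_coord (i := i)) => // x xt; rewrite -/c /d4 ler_sqr ?nnegrE; lra.
apply: (W_coord (i := i)) => //; first exact: measurable_neg.
move=> x; rewrite -leNgt -/c => xt; rewrite -[leRHS]sqrrN /d4 ler_sqr ?nnegrE; lra.
Qed.

Lemma good_measurable (B : set pt) : measurable B -> good B.
Proof.
apply: smallest_sub; first split.
- exact: good0.
- by move=> C gC; rewrite setTD; exact: goodC.
- exact: good_bigcup.
apply: (big_ind (fun S => S `<=` good)) => [|S S' h h'|i _ C [E mE <-]] //.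
  by rewrite subUset.
rewrite setTI; move: E mE.
(* For each coordinate, the sets of reals with good preimage form a sigma-algebra; it contains the
   open upper rays, which generate the Borel sets. *)
change (measurable `<=` [set E : set R | good ((fun x : pt => tnth x i) @^-1` E)]).
rewrite [X in X `<=` _]RGenOInfty.measurableE.
apply: smallest_sub; first split.
- by rewrite /= preimage_set0; exact: good0.
- by move=> E gE; rewrite /= setTD preimage_setC; exact: goodC.
- by move=> E gE; rewrite /= preimage_bigcup; exact: good_bigcup.
move=> _ [t ->] /=; rewrite (_ : _ @^-1` _ = [set x : pt | t < tnth x i]).
  exact: good_ray.
by apply/seteqP; split => x /=; rewrite in_itv/= andbT.
Qed.

End GoodSets.

(** * Expectation over the data *)

Section Data.
Variables (R : realType) (d : nat) (P : probability (pt R d * bool)%type R).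
Local Notation pt := (pt R d).
Local Notation sample := (pt * bool)%type.
Implicit Types (Z : nat -> pt) (D : seq sample).
Local Notation mass := (mass P).

Lemma data_int_ge0 (n : nat) (F : seq sample -> \bar R) :
  (forall D, (0 <= F D)%E) -> (0 <= data_int P n F)%E.
Proof.
elim: n F => [|n IH] F F0 //=.
by apply: integral_ge0 => w _; exact: IH.
Qed.

Lemma data_int_le (n : nat) (F G : seq sample -> \bar R) :
  (forall D, (0 <= F D)%E) -> (forall D, size D = n -> (F D <= G D)%E) ->
  (data_int P n F <= data_int P n G)%E.
Proof.
elim: n F G => [|n IH] F G F0 FG /=; first exact: FG.
apply: le_lower_integral => w _; first exact: data_int_ge0.
by apply: IH => // D sD; apply: FG; rewrite /= sD.
Qed.

Lemma data_int_ge (n : nat) (F : seq sample -> \bar R) (r : R) :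
  0 <= r -> (forall D, (r%:E <= F D)%E) -> (r%:E <= data_int P n F)%E.
Proof.
move=> r0; elim: n F => [|n IH] F rF //=.
rewrite -[leLHS](_ : (\int[P]_w r%:E)%E = _); last first.
  by rewrite Ex_int ?Ex_cst//; exact: bm_cst.
by apply: le_lower_integral => w _; [rewrite lee_fin|exact: IH].
Qed.

(** The offsets [t] carry the contribution of the data already drawn, so the induction integrates
    one observation at a time; cross terms vanish because [zeta m] has mean zero, and the variances
    add. *)
Lemma data_int_quad (n : nat) (s : seq nat) (zeta : nat -> sample -> R)
    (a b V : R) (t : nat -> R) :
  0 <= a -> 0 <= b ->
  (forall m, bm (zeta m)) -> (forall m, Ex P (zeta m) = 0) ->
  \sum_(m <- s) Ex P (fun w => zeta m w ^+ 2) <= V ->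
  (data_int P n (fun D => (a + b *
     \sum_(m <- s) (t m + \sum_(w <- D) zeta m w) ^+ 2)%:E) <=
   (a + b * (\sum_(m <- s) t m ^+ 2 + n%:R * V))%:E)%E.
Proof.
move=> a0 b0 bz z0 zV; elim: n t => [|n IH] t /=.
  rewrite lee_fin mul0r addr0 le_eqVlt; apply/orP; left; apply/eqP.
  by congr (_ + _ * _); apply: eq_bigr => m _; rewrite big_nil addr0.
have bt m : bm (fun w => (t m + zeta m w) ^+ 2).
  by apply: bmX; apply: bmD => //; exact: bm_cst.
have bsum : bm (fun w => \sum_(m <- s) (t m + zeta m w) ^+ 2) by exact: bm_sum.
pose g w := a + b * (\sum_(m <- s) (t m + zeta m w) ^+ 2 + n%:R * V).
have bg : bm g.
  apply: bmD; first exact: bm_cst.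
  by apply: bmZ; apply: bmD => //; exact: bm_cst.
apply: (@le_trans _ _ (\int[P]_w (g w)%:E)%E).
  apply: le_lower_integral => w _.
    apply: data_int_ge0 => D; rewrite lee_fin addr_ge0// mulr_ge0// sumr_ge0//.
    by move=> m _; exact: sqr_ge0.
  apply: le_trans (IH (fun m => t m + zeta m w)).
  apply: data_int_le => D.
    rewrite lee_fin addr_ge0// mulr_ge0// sumr_ge0//.
    by move=> m _; exact: sqr_ge0.
  move=> _; rewrite lee_fin lerD2l ler_wpM2l// le_eqVlt; apply/orP; left; apply/eqP.
  by apply: eq_bigr => m _; rewrite big_cons addrA.
rewrite Ex_int// lee_fin /g ExD; [|exact: bm_cst|]; last first.
  by apply: bmZ; apply: bmD => //; exact: bm_cst.
rewrite Ex_cst lerD2l ExZ; last by apply: bmD => //; exact: bm_cst.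
rewrite ler_wpM2l// ExD//; last exact: bm_cst.
rewrite Ex_cst Ex_sum//.
have E2 m : Ex P (fun w => (t m + zeta m w) ^+ 2) =
    t m ^+ 2 + Ex P (fun w => zeta m w ^+ 2).
  rewrite (_ : (fun w => _) = (fun w => t m ^+ 2 + (2 * t m * zeta m w + zeta m w ^+ 2))).
    rewrite ExD; [|exact: bm_cst|]; last by apply: bmD; [exact: bmZ|exact: bmX].
    rewrite Ex_cst ExD; [|exact: bmZ|exact: bmX].
    by rewrite ExZ// z0 mulr0 add0r.
  by apply/funext => w; ring.
rewrite (eq_bigr _ (fun m _ => E2 m)).
by rewrite big_split/= -addrA lerD2l -natr1 mulrDl mul1r addrC lerD2l.
Qed.

Lemma leaf_range Z (x : pt) (l : nat) : (2 ^ l <= leaf Z x l 1 < 2 * 2 ^ l)%N.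
Proof.
elim: l => [//|l]; rewrite leafS expnS; set j := leaf _ _ _ _.
by case: ifP => _; lia.
Qed.

Lemma measurable_neq_label (g : pt -> bool) : measurable_fun setT g ->
  measurable_fun setT (fun w : sample => g w.1 != w.2).
Proof.
move=> /measurable_on_fst mg; rewrite (_ : (fun w => _) = fun w : sample =>
   (g w.1 && ~~ w.2) || (~~ g w.1 && w.2)); last first.
  by apply/funext => w; case: (g w.1); case: (w.2).
have m2 : measurable_fun setT (fun w : sample => w.2) by exact: measurable_snd.
by apply: measurable_or; apply: measurable_and => //; exact: measurable_neg.
Qed.

Lemma measurable_classifier Z (p : nat) D : measurable_fun setT (classifier Z p D).
Proof.
pose vt m := (count (fun w : sample => (leaf Z w.1 p 1 == m) && ~~ w.2) D <=
   count (fun w : sample => (leaf Z w.1 p 1 == m) && w.2) D)%N.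
rewrite (_ : classifier Z p D = fun x => \big[orb/false]_(m <- index_iota (2 ^ p)
    (2 * 2 ^ p)) ((leaf Z x p 1 == m) && vt m)); last first.
  apply/funext => x.
  rewrite (bigD1_seq (leaf Z x p 1)) ?iota_uniq ?mem_index_iota ?leaf_range//=.
  rewrite eqxx/= big1 ?orbF// => m ml.
  by rewrite eq_sym (negbTE ml).
elim: (index_iota _ _) => [|m s IH].
  by under eq_fun do rewrite big_nil; exact: measurable_cst.
under eq_fun do rewrite big_cons; apply: measurable_or => //.
by apply: measurable_and => //; exact: measurable_leaf.
Qed.

(** * Error of the vote in a fixed tree *)

Section Error.
Hypothesis Pcube : P [set w | in_cube w.1] = 1%E.
Variables (Z : nat -> pt) (p : nat).
Local Notation lf x := (leaf Z x p 1).
Local Notation leaves := (index_iota (2 ^ p) (2 * 2 ^ p)).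

Let mlf (m : nat) : measurable_fun setT (fun w : sample => lf w.1 == m).
Proof. exact: (measurable_on_fst (measurable_leaf Z p m)). Qed.

Let msnd : measurable_fun setT (fun w : sample => w.2).
Proof. exact: measurable_snd. Qed.

Lemma mass_cubeI (B : pt -> bool) : measurable_fun setT B ->
  mass B = mass (fun x => B x && in_cube x).
Proof.
move=> mB; have mc := @measurable_in_cube R d.
have cc : cell (@in_cube R d) by [].
have mT := @mass_splitT R d P (fun=> true) _ (measurable_cst _) mc.
have h0 : mass (fun x => true && ~~ in_cube x) = 0.
  have : mass (fun x => true && in_cube x) = 1.
    by apply: EFin_inj; rewrite -(mass_P P cc) Pcube.
  have : mass (fun=> true) = 1.
    by rewrite mass_ind -[RHS](Ex_cst P 1).
  by move=> e1 e2; move: mT; rewrite e1 e2; lra.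
rewrite (mass_splitT P mB mc).
have h1 : mass (fun x => B x && ~~ in_cube x) <= 0.
  rewrite -h0; apply: mass_subT.
  - by apply: measurable_and => //; exact: measurable_neg.
  - by apply: measurable_and => //; exact: measurable_neg.
  - by move=> x /andP[].
have h2 := mass_ge0 P (fun x => B x && ~~ in_cube x).
have -> : mass (fun x => B x && ~~ in_cube x) = 0.
  by apply/eqP; rewrite eq_le h1 h2.
by rewrite addr0.
Qed.

Lemma Ex_leaves (f : nat -> sample -> R) : (forall m, bm (f m)) ->
  Ex P (fun w => f (lf w.1) w) =
  \sum_(m <- leaves) Ex P (fun w => (lf w.1 == m)%:R * f m w).
Proof.
move=> bf; rewrite -Ex_sum; last first.
  by move=> m; apply: bmM => //; exact: bm_ind.
apply: Ex_ext => w; rewrite (bigD1_seq (lf w.1)) ?iota_uniq//=; last first.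
  by rewrite mem_index_iota leaf_range.
rewrite eqxx mul1r big1 ?addr0// => m ml.
by rewrite eq_sym (negbTE ml) mul0r.
Qed.

(** A joint rather than conditional probability, so that the errors of the leaves add up. *)
Definition vote_err (m : nat) (b : bool) : R :=
  Ex P (fun w => (lf w.1 == m)%:R * (b != w.2)%:R).

Definition signed (m : nat) (w : sample) : R :=
  (lf w.1 == m)%:R * (if w.2 then 1 else -1).

Let bneq (b : bool) : bm (fun w : sample => (b != w.2)%:R : R).
Proof.
apply: bm_ind; case: b; last by under eq_fun do rewrite eq_sym eqbF_neg negbK.
by under eq_fun do rewrite eq_sym eqb_id; exact: measurable_neg.
Qed.

Let blf (m : nat) : bm (fun w : sample => (lf w.1 == m)%:R : R).
Proof. exact: bm_ind. Qed.

Let bsigned (m : nat) : bm (signed m).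
Proof.
apply: bmM => //; split; first exact: measurable_fun_ifT.
by exists 1 => w; case: (w.2); rewrite ?normrN1 ?normr1.
Qed.

Lemma Ex_signed (m : nat) :
  Ex P (signed m) = vote_err m false - vote_err m true.
Proof.
rewrite /vote_err -ExB; [|exact: bmM..]; apply: Ex_ext => w.
by rewrite /signed -mulrBr; case: (w.2); rewrite ?subr0 ?sub0r.
Qed.

Definition vote (m : nat) D : bool :=
  (count (fun w => (lf w.1 == m) && ~~ w.2) D <=
   count (fun w => (lf w.1 == m) && w.2) D)%N.

Lemma sum_signed (m : nat) D : \sum_(w <- D) signed m w =
  (count (fun w => (lf w.1 == m) && w.2) D)%:R -
  (count (fun w => (lf w.1 == m) && ~~ w.2) D)%:R.
Proof.
elim: D => [|w D IH]; first by rewrite big_nil subrr.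
rewrite big_cons IH /= !natrD /signed.
by case: (lf w.1 == m); case: (w.2); rewrite /=; ring.
Qed.

(* A wrong vote forces the empirical signed mass to be at least as far from
   its mean as the mean is from zero. *)
Lemma vote_err_le (m : nat) D (b : bool) (n : nat) : (0 < n)%N ->
  vote_err m (vote m D) <= vote_err m b +
    `|(\sum_(w <- D) signed m w) / n%:R - Ex P (signed m)|.
Proof.
move=> n0; rewrite Ex_signed; set S := _ / _.
have n0' : (0 : R) < n%:R^-1 by rewrite invr_gt0 ltr0n.
have [|v0] := boolP (vote m D).
  rewrite /vote -(ler_nat R) -subr_ge0 -sum_signed => v0.
  have : 0 <= S by rewrite mulr_ge0 ?(ltW n0').
  have := ler_norm (S - (vote_err m false - vote_err m true)).
  have := normr_ge0 (S - (vote_err m false - vote_err m true)).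
  by case: b; move: S (vote_err _ _) (vote_err _ _) {v0} => S e1 e0; lra.
have : S <= 0.
  move: v0; rewrite /vote -ltnNge => /ltnW; rewrite -(ler_nat R) -subr_le0.
  by rewrite -sum_signed /S pmulr_lle0.
have := ler_norm (- (S - (vote_err m false - vote_err m true))).
have := normr_ge0 (S - (vote_err m false - vote_err m true)).
by rewrite normrN; case: b; move: S (vote_err _ _) (vote_err _ _) {v0} => S e1 e0; lra.
Qed.

Variable g : pt -> bool.
Hypothesis mg : measurable_fun setT g.

Let bg : bm (fun w : sample => (g w.1 != w.2)%:R : R).
Proof. by apply: bm_ind; exact: measurable_neq_label. Qed.

Lemma mass_leaf (m : nat) (B : pt -> bool) : m \in leaves ->
  measurable_fun setT B ->
  Ex P (fun w => (lf w.1 == m)%:R * (B w.1)%:R) =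
  mass (fun x => hcell Z m x && B x).
Proof.
rewrite mem_index_iota => ml mB.
have mlB : measurable_fun setT (fun x => (lf x == m) && B x).
  by apply: measurable_and => //; exact: measurable_leaf.
rewrite (_ : Ex _ _ = mass (fun x => (lf x == m) && B x)); last first.
  by apply: Ex_ext => w; rewrite mulr1 -mulnb natrM.
rewrite mass_cubeI//; congr mass; apply/funext => x.
case: (boolP (in_cube x)) => x01; last first.
  rewrite andbF; apply/esym/negbTE; apply: contra x01 => /andP[+ _].
  exact: gcell_cube.
by rewrite andbT (@leaf_hcell _ _ Z x p)// expnS.
Qed.

(** Labelling the leaf by the value that [g] takes on most of its mass costs at most the error of
    [g] plus the mass of the minority. *)
Lemma exists_label (m : nat) : m \in leaves -> exists b : bool,
  vote_err m b <= Ex P (fun w => (lf w.1 == m)%:R * (g w.1 != w.2)%:R) +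
    min_mass P (hcell Z m) [set x | g x].
Proof.
move=> ml; have mE (x : pt) : (x \in [set x | g x]) = g x.
  by apply/idP/idP; rewrite inE.
have mgE := measurable_mem (measurable_set_bool mg).
have b1 := bmM (blf m) bg.
have key (b : bool) (B : pt -> bool) : measurable_fun setT B ->
    (forall x, B x = (g x != b)) ->
    vote_err m b <= Ex P (fun w => (lf w.1 == m)%:R * (g w.1 != w.2)%:R) +
      mass (fun x => hcell Z m x && B x).
  move=> mB BE; rewrite -mass_leaf//.
  have b2 : bm (fun w : sample => (lf w.1 == m)%:R * (B w.1)%:R : R).
    by apply: bmM => //; apply: bm_ind; exact: measurable_on_fst.
  rewrite -ExD//; apply: Ex_le => [||w]; [exact: bmM|exact: bmD|].
  rewrite -mulrDr BE; case: (lf w.1 == m); rewrite ?mul0r// !mul1r.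
  by rewrite -natrD ler_nat; case: (b) (w.2) (g w.1) => -[] [].
rewrite /min_mass; case: leP => _.
  by exists false; apply: key => // x; rewrite mE eqbF_neg negbK.
exists true; apply: key => [|x]; first exact: measurable_neg.
by rewrite mE eqb_id.
Qed.

(** In each leaf the vote is compared with the label from [exists_label]. The absolute deviation is
    traded for its square, whose expectation is explicit, at a cost of [eps / 2] per leaf. *)
Lemma classifier_error_le D (n : nat) (eps : R) :
  (0 < n)%N -> 0 < eps -> size D = n ->
  (P [set w | classifier Z p D w.1 != w.2] <=
   (Ex P (fun w => (g w.1 != w.2)%:R) +
    \sum_(m <- leaves) min_mass P (hcell Z m) [set x | g x] +
    (2 ^ p)%:R * eps / 2 +
    (2 * eps * n%:R ^+ 2)^-1 * \sum_(m <- leaves)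
      (0 + \sum_(w <- D) (signed m w - Ex P (signed m))) ^+ 2)%:E)%E.
Proof.
move=> n0 eps0 sD.
have N0 : (0 : R) < n%:R by rewrite ltr0n.
pose F (m : nat) (w : sample) : R := (vote m D != w.2)%:R.
have -> : P [set w | classifier Z p D w.1 != w.2] =
    (Ex P (fun w => F (lf w.1) w))%:E.
  rewrite (_ : (fun w => _) = ind R (fun w : sample => classifier Z p D w.1 != w.2)).
    apply: Ex_ind; apply: measurable_neq_label; exact: measurable_classifier.
  by [].
rewrite lee_fin Ex_leaves; last by move=> m; exact: bneq.
rewrite (Ex_leaves (f := fun _ w => (g w.1 != w.2)%:R)); last by move=> _; exact: bg.
rewrite mulr_sumr.
have -> : (2 ^ p)%:R * eps / 2 = \sum_(m <- leaves) (eps / 2).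
  rewrite big_const_seq count_predT size_iota iter_addr_0 -[RHS]mulr_natl.
  by rewrite -mulrA mul2n -addnn addnK.
rewrite -!big_split/= big_seq [leRHS]big_seq; apply: ler_sum => m ml.
have [b hb] := exists_label ml.
apply: le_trans (vote_err_le m D b n0) _.
rewrite -[leRHS]addrA; apply: lerD; first exact: hb.
have -> : 0 + \sum_(w <- D) (signed m w - Ex P (signed m)) =
    n%:R * ((\sum_(w <- D) signed m w) / n%:R - Ex P (signed m)).
  rewrite add0r sumrB big_const_seq count_predT iter_addr_0 sD -[in LHS]mulr_natl mulrBr.
  by rewrite mulrCA divff ?mulr1// gt_eqF.
set u := _ / _ - _.
rewrite exprMn (_ : _ * (_ * _) = u ^+ 2 / (2 * eps)); last first.
  by field; rewrite !gt_eqF.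
(* AM-GM: [|u| <= eps / 2 + u^2 / (2 eps)] *)
rewrite -subr_ge0 (_ : _ - _ = (eps - `|u|) ^+ 2 / (2 * eps)); last first.
  by rewrite -[u ^+ 2]real_normK ?num_real//; field; rewrite gt_eqF.
by rewrite divr_ge0 ?sqr_ge0// mulr_ge0// ltW.
Qed.

Lemma data_error_le (n : nat) (eps : R) : (0 < n)%N -> 0 < eps ->
  (data_int P n (fun D => P [set w | classifier Z p D w.1 != w.2]) <=
   (Ex P (fun w => (g w.1 != w.2)%:R) +
    \sum_(m <- leaves) min_mass P (hcell Z m) [set x | g x] +
    (2 ^ p)%:R * eps / 2 + (2 * eps * n%:R)^-1)%:E)%E.
Proof.
move=> n0 eps0; have N0 : (0 : R) < n%:R by rewrite ltr0n.
set a := _ + (2 ^ p)%:R * eps / 2.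
have a0 : 0 <= a.
  rewrite !addr_ge0//; first exact: Ex_ge0.
    apply: sumr_ge0 => m _; rewrite /min_mass le_min.
    by rewrite !mass_ge0.
  by rewrite divr_ge0// mulr_ge0// ltW.
pose zeta m (w : sample) := signed m w - Ex P (signed m).
have bz m : bm (zeta m) by apply: bmB => //; exact: bm_cst.
have z0 m : Ex P (zeta m) = 0.
  by rewrite ExB//; [rewrite Ex_cst subrr|exact: bm_cst].
(* The square of [signed m] is the indicator of leaf [m], and these indicators sum to 1, so the
   total variance is at most 1 whatever the number of leaves. *)
have zV : \sum_(m <- leaves) Ex P (fun w => zeta m w ^+ 2) <= 1.
  have h := Ex_leaves (f := fun _ _ => 1) (fun=> bm_cst _ 1).
  rewrite Ex_cst in h; rewrite [leRHS]h; apply: ler_sum => m _.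
  rewrite (_ : (fun w => zeta m w ^+ 2) = (fun w => (lf w.1 == m)%:R * 1 -
      (2 * Ex P (signed m) * signed m w - Ex P (signed m) ^+ 2))); last first.
    apply/funext => w; rewrite /zeta; move: (Ex P (signed m)) => s.
    by rewrite /signed; case: (lf w.1 == m); case: (w.2) => /=; ring.
  rewrite ExB; [|by apply: bmM => //; exact: bm_cst
                |by apply: bmB; [exact: bmZ|exact: bm_cst]].
  rewrite ExB; [|exact: bmZ|exact: bm_cst].
  rewrite Ex_cst ExZ//.
  set s := Ex P (signed m); rewrite (_ : 2 * s * s - s ^+ 2 = s ^+ 2); last by ring.
  by rewrite lerBlDr lerDl sqr_ge0.
pose b := (2 * eps * n%:R ^+ 2)^-1 : R.
have b0 : 0 <= b by rewrite invr_ge0 mulr_ge0 ?sqr_ge0// mulr_ge0// ltW.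
apply: le_trans (_ : (_ <= data_int P n (fun D => (a + b * \sum_(m <- leaves)
   (0 + \sum_(w <- D) zeta m w) ^+ 2)%:E))%E) _.
  apply: data_int_le => D; first exact: measure_ge0.
  exact: classifier_error_le.
apply: le_trans (data_int_quad n (fun=> 0) a0 b0 bz z0 zV) _.
rewrite lee_fin lerD2l big1 ?add0r ?mulr1; last by move=> m _; rewrite expr0n.
rewrite le_eqVlt; apply/orP; left; apply/eqP; rewrite /b; field.
by rewrite !gt_eqF.
Qed.

End Error.

End Data.

(** * Convergence of the expected error *)

Lemma error_sum_arith (R : realDomainType) (eps x l h t u s k : R) :
  x <= l + eps -> u <= t -> s <= eps + k ->
  x + s + h + u <= l + 2 * eps + h + t + k.
Proof. lra. Qed.

Lemma error_limit_arith (R : realFieldType) (eps l t K a b c : R) :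
  K * a <= c -> K * b <= eps -> 0 < eps ->
  l + 2 * eps + eps / 2 + t + K * (a + b) <= l + 4 * eps + t + c.
Proof. by rewrite mulrDr => h1 h2 e0; lra. Qed.

Section Limit.
Variables (R : realType) (d : nat) (P : probability (pt R d * bool)%type R).
Local Notation pt := (pt R d).

Lemma bayes_fin : bayes_error P = (fine (bayes_error P))%:E.
Proof.
rewrite fineK// ge0_fin_numE.
  apply: (@le_lt_trans _ _ 1%E); last exact: ltry.
  have mT := measurable_neq_label (measurable_cst true : measurable_fun [set: pt] _).
  apply: le_trans (probability_le1 P (measurable_set_bool mT)).
  by apply: ereal_inf_lbound; exists (fun=> true); first exact: measurable_cst.
by apply: le_ereal_inf_tmp => _ [g _ <-]; exact: measure_ge0.
Qed.

Lemma bayes_le (g : pt -> bool) : measurable_fun setT g ->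
  (bayes_error P <= P [set w | g w.1 != w.2])%E.
Proof. by move=> mg; apply: ereal_inf_lbound; exists g. Qed.

Lemma bayes_adherent (eps : R) : 0 < eps -> exists2 g : pt -> bool,
  measurable_fun setT g &
  Ex P (fun w => (g w.1 != w.2)%:R) <= fine (bayes_error P) + eps.
Proof.
move=> eps0; have bf : bayes_error P \is a fin_num by rewrite bayes_fin.
have [_ [g mg <-] h] := lb_ereal_inf_adherent eps0 bf.
exists g => //; rewrite -lee_fin EFinD [X in (_ <= X + _)%E]fineK//.
by have := Ex_ind P (measurable_neq_label mg); rewrite /ind => <-; exact: ltW h.
Qed.

(** The test [m \in leaves] empties the nodes of all other levels, since disjointness is required of
    the whole family. *)
Lemma disjoint_hcell Z (p : nat) (leaves := index_iota (2 ^ p) (2 * 2 ^ p)) :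
  disjoint_cells (fun m (x : pt) => (m \in leaves) && hcell Z m x).
Proof.
split=> [m|j k x].
  case: (m \in leaves) => /=; last by split.
  exact: cell_hcell.
rewrite !mem_index_iota => /andP[jl hj] /andP[kl hk].
have x01 := gcell_cube hj; move: hj hk.
by rewrite !(@leaf_hcell _ _ _ _ p) ?expnS// => /eqP <- /eqP.
Qed.

Section WithNull.
Hypothesis hd : (0 < d)%N.
Hypothesis Pcube : P [set w | in_cube w.1] = 1%E.
Hypothesis Pbis : forall a b : pt, a <> b ->
  P [set w | dist2 w.1 a == dist2 w.1 b] = 0%E.
Hypothesis Patom : forall b : pt, P [set w | w.1 == b] = 0%E.

Lemma expected_error_ge (alpha : R) (n : nat) :
  (bayes_error P <= expected_error P alpha n)%E.
Proof.
have b0 : 0 <= fine (bayes_error P).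
  rewrite fine_ge0//; by apply: le_ereal_inf_tmp => _ [g _ <-]; exact: measure_ge0.
rewrite bayes_fin; apply: tree_int_ge => // [Z|]; last exact: frontier_root.
apply: data_int_ge => // D; rewrite -bayes_fin.
exact: bayes_le (measurable_classifier Z _ D).
Qed.

Lemma mass_le1 (A : pt -> bool) : cell A -> mass P A <= 1.
Proof.
move=> cA; rewrite -lee_fin -mass_P//; apply: probability_le1.
apply: measurable_set_bool; apply: (measurable_on_fst (h := A)).
by case: cA.
Qed.

(** [K] and [lam] are fixed before [alpha] and [n]. The term [4 * eps] covers the near-optimality of
    [g], its approximation by cells, the cost [eps / 2] of the votes, and the residual scatter. *)
Lemma expected_error_le (eps : R) : 0 < eps -> exists (K lam : R),
  [/\ 0 <= K, 0 < lam, lam < 1 & forall (alpha : R) (n : nat), (0 < n)%N ->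
   (expected_error P alpha n <= (fine (bayes_error P) + 4 * eps +
     (2 ^ depth alpha n)%:R / n%:R / eps +
     K * (1 - lam) ^+ depth alpha n)%:E)%E].
Proof.
move=> eps0; have [g mg gL] := bayes_adherent eps0.
have [mB gB] := good_measurable P (measurable_set_bool mg).
have [K K0 hK] := gB _ eps0.
have K10 : 0 < K + 1 by rewrite ltr_wpDl.
(* The residual scatter gets multiplied by [K], hence this threshold; adding 1 allows [K = 0]. *)
have v0 : 0 < eps / (K + 1) by rewrite divr_gt0.
have [lam [lam0 lam1 contr]] := W_contraction P hd v0.
exists (K * d%:R), lam; split => //; first by rewrite mulr_ge0.
move=> alpha n n0; set p := depth alpha n.
have N0 : (0 : R) < n%:R by rewrite ltr0n.
have tp0 : (0 : R) < (2 ^ p)%:R by rewrite ltr0n expn_gt0.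
(* This choice makes the total cost over [2 ^ p] leaves [eps / 2], and the variance term half of
   [2 ^ p / n / eps]. *)
pose e := eps / (2 ^ p)%:R; have e0 : 0 < e by rewrite divr_gt0.
set L := fine _ in gL *.
pose r := L + 2 * eps + eps / 2 + (2 ^ p)%:R / n%:R / eps.
have hF Z : (data_int P n (fun D => P [set w | classifier Z p D w.1 != w.2]) <=
    (r + K * \sum_(2 ^ p <= m < 2 * 2 ^ p) W P (hcell Z m))%:E)%E.
  apply: le_trans (data_error_le Pcube Z p mg n0 e0) _; rewrite lee_fin.
  pose leaves := index_iota (2 ^ p) (2 * 2 ^ p).
  have AE m : m \in leaves -> (fun x => (m \in leaves) && hcell Z m x) = hcell Z m.
    by move=> ml; apply/funext => x; rewrite ml.
  have := hK _ leaves (disjoint_hcell Z p) (iota_uniq _ _).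
  rewrite [X in X <= _](eq_big_seq (fun m => min_mass P (hcell Z m) [set x | g x]));
    last by move=> m ml; rewrite AE.
  rewrite [X in K * X](eq_big_seq (fun m => W P (hcell Z m)));
    last by move=> m ml; rewrite AE.
  have -> : (2 ^ p)%:R * e / 2 = eps / 2 by rewrite /e; field; rewrite gt_eqF.
  have : (2 * e * n%:R)^-1 <= (2 ^ p)%:R / n%:R / eps.
    rewrite (_ : _^-1 = (2 ^ p)%:R / n%:R / eps / 2); last first.
      by rewrite /e; field; rewrite !gt_eqF.
    by rewrite ler_pdivrMr// ler_peMr ?ler1n// !divr_ge0// ltW.
  exact: error_sum_arith gL.
have fuelE : (2 ^ p - 1 + 1)%N = (2 ^ p)%N by rewrite subnK// expn_gt0.
have F0 Z : (0 <= data_int P n (fun D => P [set w | classifier Z p D w.1 != w.2]))%E.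
  by apply: data_int_ge0 => D; exact: measure_ge0.
have := tree_int_le Pbis Patom lam1 contr (ltn0Sn 0) fuelE K0 F0 hF
  (frontier_root Pcube (Z0 R d)).
move=> /le_trans; apply.
rewrite lee_fin mul2n big_nat1 /pot trunc_log1 subn0.
have cH := cell_hcell (Z0 R d) 1.
have q1 : 0 <= (1 - lam) ^+ p <= 1.
  by rewrite exprn_ge0 ?exprn_ile1// ?subr_ge0 ?(ltW lam1)// gerBl ltW.
have w1 : W P (hcell (Z0 R d) 1) <= d%:R.
  apply: le_trans (W_le_mass P cH) _.
  by rewrite ler_piMr// mass_le1.
have m1 := mass_le1 cH; have m0 := mass_ge0 P (hcell (Z0 R d) 1).
move: q1 w1 m1 m0; set q := _ ^+ p.
move: (mass _ _) (W _ _) => m w /andP[q0 q1] w1 m1 m0.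
have h1 : K * (q * w) <= K * d%:R * q.
  by rewrite -mulrA ler_wpM2l// mulrC ler_wpM2r.
have h2 : K * (eps / (K + 1) * (1 - q) * m) <= eps.
  rewrite -!mulrA [leLHS]mulrCA; apply: ler_piMr; first exact: ltW.
  rewrite mulrCA; apply: le_trans (_ : (K + 1)^-1 * K <= _); last first.
    by rewrite ler_pdivrMl// mulr1 lerDl.
  apply: ler_wpM2l; first by rewrite invr_ge0 ltW.
  rewrite ler_piMr// mulr_ile1// ?subr_ge0// gerBl//.
exact: error_limit_arith h1 h2 eps0.
Qed.

(** * Growth of the depth against the sample size *)

Lemma ln_nat_ge (T : R) : exists N : nat, forall n : nat, (N <= n)%N ->
  T <= ln (n%:R : R).
Proof.
exists (Num.truncn (expR T)).+1 => n Nn; rewrite -[leLHS]expRK ler_ln.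
- by apply: ltW; apply: lt_le_trans (truncnS_gt _) _; rewrite ler_nat.
- by rewrite posrE expR_gt0.
- by rewrite posrE ltr0n; apply: leq_ltn_trans Nn.
Qed.

Variable alpha : R.
Hypothesis ha0 : 0 < alpha.
Hypothesis ha1 : alpha < 1 / ln 2.

Lemma depth_ge (p : nat) : exists N : nat, forall n : nat, (N <= n)%N ->
  (p <= depth alpha n)%N.
Proof.
have [N hN] := ln_nat_ge (p%:R / alpha); exists N => n /hN.
rewrite ler_pdivrMr// mulrC => h; rewrite /depth truncn_ge_nat//.
exact: le_trans h.
Qed.

Lemma leaves_density (del : R) : 0 < del -> exists N : nat, forall n : nat,
  (N <= n)%N -> (2 ^ depth alpha n)%:R / n%:R <= del.
Proof.
move=> del0.
have l2 : 0 < ln 2 :> R by rewrite ln_gt0// ltr1n.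
have c0 : 0 < 1 - alpha * ln 2.
  by rewrite subr_gt0 -ltr_pdivlMr.
(* The maximum with 0 makes [ln n] nonnegative, so that the truncated depth does not exceed
   [alpha * ln n]. *)
have [N hN] := ln_nat_ge (Num.max 0 (- ln del / (1 - alpha * ln 2))).
exists N.+1 => n Nn; have := hN n (ltnW Nn); rewrite ge_max => /andP[ln0].
rewrite ler_pdivrMr// => hln.
have n0 : (0 : R) < n%:R by rewrite ltr0n; case: n Nn {hN ln0 hln}.
rewrite -(lnK (x := del)) ?posrE//.
(* The exponent is at most [-(1 - alpha * ln 2) * ln n], and the bound on [alpha] makes the
   coefficient of [ln n] negative. *)
have -> : (2 ^ depth alpha n)%:R / n%:R =
    expR ((depth alpha n)%:R * ln 2 - ln n%:R) :> R.
  by rewrite expRB expRM_natl !lnK ?posrE// natrX.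
rewrite ler_expR.
have : (depth alpha n)%:R <= alpha * ln (n%:R : R).
  by rewrite /depth truncn_le mulr_ge0// ltW.
move=> /(ler_wpM2r (ltW l2)) h.
by move: h hln; move: (ln n%:R) (ln del) => *; nra.
Qed.

Lemma expected_error_near (eps : R) : 0 < eps -> exists N : nat,
  forall n, (N <= n)%N ->
  (expected_error P alpha n <= (fine (bayes_error P) + eps)%:E)%E.
Proof.
(* Four shares go to [expected_error_le], one to the ratio of leaves to data, one to the
   contraction. That ratio is divided by [e], hence its threshold [e * e]. *)
move=> eps0; pose e := eps / 6; have e0 : 0 < e by rewrite divr_gt0.
have [K [lam [K0 lam0 lam1 h]]] := expected_error_le e0.
have [N1 h1] := leaves_density (mulr_gt0 e0 e0).
have K10 : 0 < K + 1 by rewrite ltr_wpDl.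
have eK : 0 < e / (K + 1) by rewrite divr_gt0.
have q1 : `|1 - lam| < 1 by rewrite ger0_norm ?subr_ge0 ?(ltW lam1)// gtrBl.
have /cvgrPdist_le/(_ _ eK)[p _ hp] := cvg_expr q1.
have [N2 h2] := depth_ge p.
exists (maxn 1 (maxn N1 N2)) => n; rewrite !geq_max => /and3P[n0 n1 n2].
apply: le_trans (h alpha n n0) _; rewrite lee_fin.
have t1 : (2 ^ depth alpha n)%:R / n%:R / e <= e.
  by rewrite ler_pdivrMr//; exact: h1.
have t2 : K * (1 - lam) ^+ depth alpha n <= e.
  have := hp _ (h2 n n2); rewrite /= sub0r normrN => /ler_normlW.
  rewrite ler_pdivlMr// => hq; apply: le_trans hq.
  rewrite mulrC ler_wpM2l ?lerDl//.
  by rewrite exprn_ge0// subr_ge0 ltW.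
have -> : fine (bayes_error P) + eps = fine (bayes_error P) + 4 * e + e + e.
  by rewrite /e; field.
by apply: lerD => //; apply: lerD.
Qed.

Lemma expected_error_cvg :
  (expected_error P alpha n @[n --> \oo] --> bayes_error P)%E.
Proof.
rewrite bayes_fin; set L := fine _.
have lo n : (L%:E <= expected_error P alpha n)%E.
  by rewrite -bayes_fin; exact: expected_error_ge.
have fin n (eps : R) : (expected_error P alpha n <= (L + eps)%:E)%E ->
    expected_error P alpha n \is a fin_num.
  move=> hi; rewrite fin_numElt (lt_le_trans (ltNyr _) (lo n))/=.
  exact: le_lt_trans hi (ltry _).
apply/fine_cvgP; split.
  have [N hN] := expected_error_near ltr01; exists N => // n /= /hN.
  exact: fin.
apply/cvgrPdist_le => eps eps0.
have [N hN] := expected_error_near eps0; exists N => // n /= /hN h.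
have fn := fin _ _ h; move: h (lo n); rewrite -(fineK fn) !lee_fin => h1 h2.
by rewrite distrC ger0_norm ?subr_ge0// lerBlDl.
Qed.

End WithNull.
End Limit.

Theorem theorem1 (R : realType) (d : nat) (hd : (0 < d)%N)
  (P : probability (pt R d * bool)%type R) (f : pt R d -> R)
  (mf : measurable_fun setT f)
  (hf : has_density P f)
  (fbnd : exists c C : R, 0 < c /\
     forall x : pt R d, in_cube x -> c <= f x <= C)
  (alpha : R) (ha0 : 0 < alpha) (ha1 : alpha < 1 / ln 2) :
  (expected_error P alpha n @[n --> \oo] --> bayes_error P)%E.
Proof.
apply: expected_error_cvg => //.
- exact: density_cube hf.
- exact: density_bisector hf.
- by move=> b; exact: density_atom hf b hd.
Qed.
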